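(* Let $B_q$ be the set of complete flags $(V_1,V_2)$ in $\mathbb{F}_q^3$ ($0<V_1<V_2<\mathbb{F}_q^3$, $\dim V_1=1$, $\dim V_2=2$) and $\Phi_q:\mathrm{SL}_3(\mathbb{Z})\to\mathrm{Sym}(B_q)$ the action via reduction modulo $q$. There exists a constant $C>0$ such that for every $\epsilon>0$ there is a constant $A_\epsilon$ such that for every prime $q$ and every $T\le Cq^3$, \[ \left|\left\{(\gamma,x)\in\mathrm{SL}_3(\mathbb{Z})\times B_q:\|\gamma\|_\infty\|\gamma^{-1}\|_\infty\le T,\ \Phi_q(\gamma)(x)=x\right\}\right|\le A_\epsilon\,q^{3+\epsilon}T. \]
   Context: $\|\gamma\|_\infty$ denotes the maximum absolute value of the entries of $\gamma$. *)

(* Defs.v *)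
From HB Require Import structures.
From mathcomp Require Import all_boot all_order all_algebra all_fingroup.
From mathcomp Require Import all_classical all_reals all_analysis.

Set Implicit Arguments.
Unset Strict Implicit.
Unset Printing Implicit Defensive.

Import Order.TTheory GRing.Theory Num.Theory.
Import numFieldNormedType.Exports.

Local Open Scope ring_scope.

(* [{vspace vT}] is only a choiceType in the library; [{perm _}] needs finiteness. *)
Section FiniteVspace.
Import VectorInternalTheory.
Variables (F : finFieldType) (vT : vectType F).
HB.instance Definition _ := [Countable of {vspace vT} by <:].
HB.instance Definition _ := [Finite of {vspace vT} by <:].
End FiniteVspace.

Section Flags.
Variable F : finFieldType.

Definition is_flag (V : {vspace 'cV[F]_3} * {vspace 'cV[F]_3}) : bool :=
  [&& (V.1 <= V.2)%VS, \dim V.1 == 1%N & \dim V.2 == 2].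

Record flag : Type :=
  Flag { flag_val :> {vspace 'cV[F]_3} * {vspace 'cV[F]_3};
         flag_valP : is_flag flag_val }.

HB.instance Definition _ := [isSub for flag_val].
HB.instance Definition _ := [Finite of flag by <:].

Definition mxlfun (g : 'M[F]_3) : 'End('cV[F]_3) := linfun (mulmx g).

Lemma mxlfunE g v : mxlfun g v = g *m v.
Proof. by rewrite lfunE. Qed.

Lemma mxlfun_ker0 g : g \in unitmx -> lker (mxlfun g) == 0%VS.
Proof.
by move=> ug; apply/lker0P => u v; rewrite !mxlfunE; apply: (can_inj (mulKmx ug)).
Qed.

Lemma flag_actP (g : 'M[F]_3) (V : flag) : g \in unitmx ->
  is_flag ((mxlfun g @: (val V).1)%VS, (mxlfun g @: (val V).2)%VS).
Proof.
case: V => -[V1 V2] /= /and3P[/= sV d1 d2] ug; apply/and3P => /=.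
have K0 := eqP (mxlfun_ker0 ug).
by rewrite limgS// !limg_dim_eq// K0 capv0.
Qed.

Definition flag_act (g : 'M[F]_3) (ug : g \in unitmx) (V : flag) : flag :=
  Flag (flag_actP V ug).

Lemma flag_act_inj (g : 'M[F]_3) (ug : g \in unitmx) : injective (flag_act ug).
Proof.
have K0 := mxlfun_ker0 ug.
move=> [[V1 V2] pV] [[W1 W2] pW] [e1 e2]; apply: val_inj => /=.
have inj : injective (fun U : {vspace 'cV[F]_3} => mxlfun g @: U)%VS.
  by move=> U W /eqP; rewrite eqEsubv !limg_ker0// -eqEsubv => /eqP.
by congr pair; apply: inj.
Qed.

Definition flag_perm (g : 'M[F]_3) (ug : g \in unitmx) : {perm flag} :=
  perm (@flag_act_inj g ug).

End Flags.

Record SL3Z : Type := MkSL3Z { SL3Z_val :> 'M[int]_3; _ : \det SL3Z_val == 1 }.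

HB.instance Definition _ := [isSub for SL3Z_val].
HB.instance Definition _ := [Choice of SL3Z by <:].

Lemma SL3Z_unit (g : SL3Z) : (g : 'M[int]_3) \in unitmx.
Proof. by case: g => g /= /eqP dg; rewrite unitmxE dg unitr1. Qed.

Definition redmod (q : nat) (g : 'M[int]_3) : 'M['F_q]_3 := map_mx intr g.

Lemma redmod_unit (q : nat) (g : SL3Z) : redmod q g \in unitmx.
Proof.
case: g => g /= /eqP dg.
by rewrite /redmod unitmxE det_map_mx dg rmorph1 unitr1.
Qed.

(* For [q] prime, ['F_q] is the field with [q] elements. *)
Definition Phi (q : nat) (g : SL3Z) : {perm flag 'F_q} :=
  flag_perm (redmod_unit q g).

Lemma PhiM (q : nat) (g h gh : SL3Z) (V : flag 'F_q) :
  val gh = val g *m val h -> Phi q gh V = Phi q g (Phi q h V).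
Proof.
move=> e; rewrite !permE; apply: val_inj => /=.
have -> : mxlfun (redmod q gh) = (mxlfun (redmod q g) \o mxlfun (redmod q h))%VF.
  apply/lfunP => v; rewrite comp_lfunE !mxlfunE /redmod.
  by rewrite (e : SL3Z_val gh = _) map_mxM mulmxA.
by rewrite !limg_comp.
Qed.

(* [`|g|] on matrices is [mx_norm], the maximum of the absolute values of the
   entries; [invmx g] is the actual inverse, by [SL3Z_unit]. *)
Definition fixed_pairs (R : realType) (q : nat) (T : R) :
    set (SL3Z * flag 'F_q) :=
  [set p : SL3Z * flag 'F_q | (`|(p.1 : 'M[int]_3)| * `|invmx (p.1 : 'M[int]_3)|)%:~R <= T
         /\ Phi q p.1 p.2 = p.2]%classic.
Arguments fixed_pairs {R} q T.

(* Main.v *)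
Require Import Defs.
From HB Require Import structures.
From mathcomp Require Import all_boot all_order all_algebra all_fingroup.
From mathcomp Require Import all_classical all_reals all_analysis.
From mathcomp Require Import zify ring lra.
Import Order.TTheory GRing.Theory Num.Theory.
Import numFieldNormedType.Exports.
Local Open Scope ring_scope.

(* Proof idea.  Put X = |g|, Y = |g^-1|, so XY <= T.  The number of flags fixed
   by g mod q is O(q^3) always, O(q) unless g is scalar mod q, and O(1) unless
   g is derogatory mod q, i.e. g^-1 = l + mu g mod q.  So, up to powers of
   log q, it suffices to count O(T) scalar g, O(q^2 T) derogatory g and
   O(q^3 T) arbitrary g.

   Conjugating by one of 12 fixed matrices, we may assume that the corner entry
   c of g <> 1 is comparable to X.  Let r1, r2, r3 be the rows of g, c and z the
   last entries of r1 and r2, d = gcd(c, z), and w = (w1, w2) the first two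
   entries of r1 x r2, which are multiples of d of size at most T/|c|.  Given
   (c, z, w), the other entries of r1 and r2 lie on two lines with O(d) integer
   points each, and r3 is determined modulo the lattice spanned by r1 and r2,
   which leaves O(T / (|c| |w|)) choices.  Summing gives O(T^2 log^3 T) matrices.
   For a derogatory g the entries of g^-1 are mu times those of g off the
   diagonal, whence z w1 = c w2 mod q; this gains a factor q and leaves
   O(T^2/q + q^2 T), as |c|^3 <= 2 T^2 < q^6.  If g is a scalar s mod q, then
   s^3 = 1, so g mod q takes at most 3 values, and q divides d; hence w and r3
   are determined and each line only carries O(d/q) points: in total there are
   O((X/q)^3) = O(T^2/q^3) such matrices. *)

Set Implicit Arguments.
Unset Strict Implicit.
Unset Printing Implicit Defensive.

(** * Counting by covers *)

Section AtMost.
Variable R : realFieldType.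
Implicit Types T : eqType.

(** A cardinality bound that includes finiteness; a real [N] allows the bound to be a sum of
    fractions. *)
Definition atmost T (P : T -> Prop) (N : R) : Prop :=
  forall s : seq T, uniq s -> (forall x, x \in s -> P x) -> (size s)%:R <= N.

Lemma atmost_le T (P : T -> Prop) (N M : R) : N <= M -> atmost P N -> atmost P M.
Proof. by move=> NM PN s us Ps; apply: le_trans NM; apply: PN. Qed.

Lemma atmost_sub T (P Q : T -> Prop) (N : R) :
  (forall x, P x -> Q x) -> atmost Q N -> atmost P N.
Proof. by move=> PQ QN s us Ps; apply: QN => // x /Ps /PQ. Qed.

Lemma atmost_inj T T' (f : T -> T') (P : T -> Prop) (Q : T' -> Prop) (N : R) :
    (forall x y, P x -> P y -> f x = f y -> x = y) ->
    (forall x, P x -> Q (f x)) ->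
  atmost Q N -> atmost P N.
Proof.
move=> finj PQ QN s us Ps; rewrite -(size_map f); apply: QN.
  by rewrite map_inj_in_uniq // => x y /Ps Px /Ps Py; apply: finj.
by move=> _ /mapP[x /Ps Px ->]; apply: PQ.
Qed.

Lemma atmost1 T (P : T -> Prop) (N : R) :
  (forall x y, P x -> P y -> x = y) -> 1 <= N -> atmost P N.
Proof.
move=> P1 N1 [|x [|y s]] us Ps; rewrite /= ?(le_trans _ N1)//.
have xy : x = y by apply: P1; apply: Ps; rewrite !inE eqxx ?orbT.
by move: us; rewrite /= xy inE eqxx.
Qed.

Lemma atmost0 T (P : T -> Prop) (N : R) : (forall x, ~ P x) -> 0 <= N -> atmost P N.
Proof. by move=> P0 N0 [|x s] us Ps //; case: (P0 x); apply: Ps; rewrite mem_head. Qed.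

Lemma atmost_or T (P Q1 Q2 : T -> Prop) (N1 N2 : R) :
    (forall x, P x -> Q1 x \/ Q2 x) ->
  atmost Q1 N1 -> atmost Q2 N2 -> atmost P (N1 + N2).
Proof.
move=> PQ h1 h2 s us Ps; rewrite -(count_predC (fun x => `[< Q1 x >])) natrD.
rewrite -!size_filter; apply: lerD.
  by apply: h1; rewrite ?filter_uniq// => x; rewrite mem_filter => /andP[/asboolP].
apply: h2; rewrite ?filter_uniq// => x; rewrite mem_filter => /andP[/= /asboolPn nQ /Ps].
by move=> /PQ[].
Qed.

Lemma atmost_cover T (I : eqType) (L : seq I) (Q : I -> T -> Prop) (N : I -> R)
    (P : T -> Prop) :
    (forall x, P x -> exists2 l, l \in L & Q l x) ->
    (forall l, l \in L -> atmost (Q l) (N l)) ->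
  atmost P (\sum_(l <- L) N l).
Proof.
elim: L P => [|l L IH] P PQ QN.
  by rewrite big_nil; apply: atmost0 => // x /PQ[].
rewrite big_cons.
apply: (@atmost_or _ _ (Q l) (fun x => exists2 l, l \in L & Q l x)).
- move=> x /PQ[k]; rewrite inE => /predU1P[->|kL] Qx; [by left|by right; exists k].
- by apply: QN; rewrite mem_head.
- by apply: IH => // k kL; apply: QN; rewrite inE kL orbT.
Qed.

Lemma atmost_cover_cst T (I : eqType) (L : seq I) (Q : I -> T -> Prop) (N : R)
    (P : T -> Prop) :
    (forall x, P x -> exists2 l, l \in L & Q l x) ->
    (forall l, l \in L -> atmost (Q l) N) ->
  atmost P ((size L)%:R * N).
Proof.
move=> PQ QN; have := @atmost_cover _ _ L Q (fun=> N) P PQ QN.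
by rewrite big_const_seq count_predT iter_addr_0 mulr_natl.
Qed.

End AtMost.

(** * Sums over intervals of integers, and harmonic numbers *)

Definition sint (n : nat) : seq int :=
  [seq i%:Z | i <- iota 1 n] ++ [seq - i%:Z | i <- iota 1 n].

Definition irange (n : nat) : seq int := 0 :: sint n.

Lemma mem_sint n z : (z \in sint n) = (0 < `|z| <= n)%N.
Proof.
rewrite mem_cat; apply/orP/idP => [[]/mapP[i]|]; rewrite ?mem_iota; try lia.
by move=> h; case: (leP 0 z) => z0; [left|right]; apply/mapP; exists `|z|%N;
  rewrite ?mem_iota; lia.
Qed.

Lemma mem_irange n z : (z \in irange n) = (`|z| <= n)%N.
Proof. by rewrite inE mem_sint; lia. Qed.

Lemma size_irange n : size (irange n) = n.*2.+1.
Proof. by rewrite /= size_cat !size_map size_iota addnn. Qed.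

Section Sums.
Variable R : realFieldType.

Lemma sum_sint n (f : nat -> R) :
  \sum_(z <- sint n) f `|z|%N = 2 * \sum_(1 <= i < n.+1) f i.
Proof.
rewrite big_cat !big_map /= /index_iota subn1 /=.
by under [X in _ + X]eq_bigr do rewrite abszN; rewrite mulr2n mulrDl mul1r.
Qed.

Lemma sum_irange n (f : nat -> R) :
  \sum_(z <- irange n) f `|z|%N = f 0%N + 2 * \sum_(1 <= i < n.+1) f i.
Proof. by rewrite big_cons sum_sint. Qed.

Definition harm (n : nat) : R := \sum_(1 <= i < n.+1) i%:R^-1.

Lemma harm_ge0 n : 0 <= harm n.
Proof. by apply: sumr_ge0 => i _; rewrite invr_ge0. Qed.

Lemma harm_le m n : (m <= n)%N -> harm m <= harm n.
Proof.
move=> mn; rewrite /harm (@big_cat_nat _ _ _ m.+1 1 n.+1)//=.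
by rewrite lerDl; apply: sumr_ge0 => i _; rewrite invr_ge0.
Qed.

Lemma harm_ge1 n : (0 < n)%N -> 1 <= harm n.
Proof. by move=> n0; apply: le_trans (harm_le n0); rewrite /harm big_nat1 invr1. Qed.

(** Each dyadic block from [2 ^ k + 1] to [2 ^ k.+1] contributes at most 1. *)
Lemma harm_pow2 k : harm (2 ^ k) <= k.+1%:R.
Proof.
elim: k => [|k IH]; first by rewrite /harm big_nat1 invr1.
have le2 : (2 ^ k <= 2 ^ k.+1)%N by rewrite leq_exp2l.
rewrite /harm (@big_cat_nat _ _ _ (2 ^ k).+1 1 (2 ^ k.+1).+1)//=.
rewrite -[k.+2]addn1 natrD; apply: lerD => //.
have p0 : 0 < (2 ^ k)%:R :> R by rewrite ltr0n expn_gt0.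
apply: (@le_trans _ _ (\sum_((2 ^ k).+1 <= i < (2 ^ k.+1).+1) (2 ^ k)%:R^-1)).
  apply: ler_sum_nat => i /andP[ki _]; have i0 : (0 < i)%N by lia.
  by rewrite lef_pV2 ?posrE ?ltr0n ?expn_gt0 ?ler_nat ?(ltnW ki).
have -> : \sum_((2 ^ k).+1 <= i < (2 ^ k.+1).+1) (2 ^ k)%:R^-1 = 1 :> R; last by [].
rewrite sumr_const_nat (_ : (_ - _)%N = (2 ^ k)%N); last by rewrite expnS; lia.
by rewrite -[LHS]mulr_natr mulVf// gt_eqF.
Qed.

Lemma harm_log n : harm n <= (trunc_log 2 n).+2%:R.
Proof. by apply: le_trans (harm_pow2 _); apply: harm_le; apply/ltnW/trunc_log_ltn. Qed.

End Sums.

(** * Integer matrices of order 3 *)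

Definition i0 : 'I_3 := @Ordinal 3 0 isT.
Definition i1 : 'I_3 := @Ordinal 3 1 isT.
Definition i2 : 'I_3 := @Ordinal 3 2 isT.

Lemma I3P (i : 'I_3) : [\/ i = i0, i = i1 | i = i2].
Proof.
by case: i => [[|[|[|//]]] h]; [constructor 1|constructor 2|constructor 3]; apply: val_inj.
Qed.

Lemma big_I3 (V : nmodType) (F : 'I_3 -> V) : \sum_i F i = F i0 + F i1 + F i2.
Proof.
rewrite !big_ord_recl big_ord0 addr0 addrA.
by congr (_ + _ + _); congr F; apply: val_inj.
Qed.

Section Mat3.
Variable S : comNzRingType.
Implicit Types A B : 'M[S]_3.

Lemma det3 A : \det A =
  A i0 i0 * (A i1 i1 * A i2 i2 - A i1 i2 * A i2 i1)
  - A i0 i1 * (A i1 i0 * A i2 i2 - A i1 i2 * A i2 i0)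
  + A i0 i2 * (A i1 i0 * A i2 i1 - A i1 i1 * A i2 i0).
Proof.
rewrite (expand_det_row _ i0) big_I3 /cofactor.
rewrite !(expand_det_row _ ord0) !big_ord_recl !big_ord0 /cofactor !det_mx11 !mxE.
pose F m n := A (inord m) (inord n).
have EF (i j : 'I_3) : A i j = F i j by rewrite /F !inord_val.
rewrite !EF /= /bump /= !expr0 !expr1 ?sqrrN ?expr1n; ring.
Qed.

(** The adjugate: with indices taken cyclically modulo 3, the cofactors need no signs. *)
Definition adj3 A : 'M[S]_3 := \matrix_(i, j)
  let succ (k : 'I_3) : 'I_3 := inord (k.+1 %% 3) in
  A (succ j) (succ i) * A (succ (succ j)) (succ (succ i))
  - A (succ j) (succ (succ i)) * A (succ (succ j)) (succ i).

Lemma adj3E A :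
  (adj3 A i0 i0 = A i1 i1 * A i2 i2 - A i1 i2 * A i2 i1) *
  (adj3 A i0 i1 = A i2 i1 * A i0 i2 - A i2 i2 * A i0 i1) *
  (adj3 A i0 i2 = A i0 i1 * A i1 i2 - A i0 i2 * A i1 i1) *
  (adj3 A i1 i0 = A i1 i2 * A i2 i0 - A i1 i0 * A i2 i2) *
  (adj3 A i1 i1 = A i2 i2 * A i0 i0 - A i2 i0 * A i0 i2) *
  (adj3 A i1 i2 = A i0 i2 * A i1 i0 - A i0 i0 * A i1 i2) *
  (adj3 A i2 i0 = A i1 i0 * A i2 i1 - A i1 i1 * A i2 i0) *
  (adj3 A i2 i1 = A i2 i0 * A i0 i1 - A i2 i1 * A i0 i0) *
  (adj3 A i2 i2 = A i0 i0 * A i1 i1 - A i0 i1 * A i1 i0).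
Proof.
have s0 : inord ((0 : nat).+1 %% 3) = i1 by apply: val_inj; rewrite /= inordK.
have s1 : inord ((1 : nat).+1 %% 3) = i2 by apply: val_inj; rewrite /= inordK.
have s2 : inord ((2 : nat).+1 %% 3) = i0 by apply: val_inj; rewrite /= inordK.
by rewrite !mxE /= -!/i0 -!/i1 -!/i2; do !rewrite ?s0 ?s1 ?s2 /=.
Qed.

Lemma mul_adj3 A : A *m adj3 A = (\det A)%:M.
Proof.
apply/matrixP => i j; rewrite !mxE big_I3 det3.
by case: (I3P i) => ->; case: (I3P j) => ->; rewrite !adj3E /= ?mulr1n ?mulr0n; ring.
Qed.

End Mat3.

Lemma invmx3 (S : comUnitRingType) (A : 'M[S]_3) : \det A = 1 -> invmx A = adj3 A.
Proof.
move=> dA; have uA : A \in unitmx by rewrite unitmxE dA unitr1.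
by rewrite -[RHS](mulKmx uA) mul_adj3 dA mulmx1.
Qed.

(** Congruent integers have equal remainders, so within a residue class modulo [w] the quotient
    identifies the integer. Quotients serve as codes in the counts below. *)
Lemma divz_inj (w x y : int) :
  w != 0 -> (w %| x - y)%Z -> (x %/ w = y %/ w)%Z -> x = y.
Proof.
move=> w0; rewrite -eqz_mod_dvd => /eqP xy dxy.
by rewrite (divz_eq x w) (divz_eq y w) dxy xy.
Qed.

Lemma divz_bound (w x : int) : w != 0 -> (`|(x %/ w)%Z| * `|w| <= `|x| + `|w|)%N.
Proof.
move=> w0; have := modz_ge0 x w0; have := ltz_mod x w0; have := divz_eq x w.
rewrite -abszM; move: (_ * w) => p; lia.
Qed.

(* The solutions of [b z - c y = u] form a coset of the multiples of [(c, z)]. *)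
Lemma line_inj (e c z b b' y y' : int) :
    coprimez c z -> c != 0 -> e != 0 -> (e %| b - b')%Z -> (e %| y - y')%Z ->
    b * z - c * y = b' * z - c * y' ->
    (b %/ (c * e) = b' %/ (c * e))%Z ->
  b = b' /\ y = y'.
Proof.
move=> cz c0 e0 eb ey eq_u eq_div.
have lin : (b - b') * z = c * (y - y').
  apply/eqP; rewrite -subr_eq0.
  by move/eqP: eq_u; rewrite -subr_eq0; congr (_ == 0); ring.
have /dvdzP[k bk] : (c %| b - b')%Z.
  by rewrite -(Gauss_dvdzl _ cz) lin dvdz_mulr.
have yk : y - y' = k * z by apply: (mulfI c0); rewrite -lin bk; ring.
have ek : (e %| k)%Z.
  rewrite bk in eb; rewrite yk in ey.
  have : (e %| gcdz (k * c) (k * z))%Z by rewrite dvdz_gcd eb ey.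
  by rewrite -mulz_gcdr (eqP cz) mulr1 !dvdzE absz_nat.
have bb : b = b'.
  apply: divz_inj eq_div; first by rewrite mulf_neq0.
  by rewrite bk mulrC dvdz_mul.
split=> //; move: lin; rewrite bb subrr mul0r => /esym/eqP.
by rewrite mulf_eq0 (negPf c0) subr_eq0 => /eqP.
Qed.

(* [(w1, w2)] and [(v1, v2)] are the first two entries of the cross products of
   the first row of [A] with its second and third row. *)
Definition w1 (A : 'M[int]_3) := A i0 i1 * A i1 i2 - A i0 i2 * A i1 i1.
Definition w2 (A : 'M[int]_3) := A i0 i2 * A i1 i0 - A i0 i0 * A i1 i2.
Definition v1 (A : 'M[int]_3) := A i0 i1 * A i2 i2 - A i0 i2 * A i2 i1.
Definition v2 (A : 'M[int]_3) := A i0 i2 * A i2 i0 - A i0 i0 * A i2 i2.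

(* Used with [e = 1], and with [e = q] for matrices in one residue class mod [q]. *)
Lemma pivot_inj (e g c z : int) (A B : 'M[int]_3) :
    \det A = 1 -> \det B = 1 -> g != 0 -> c != 0 -> coprimez c z -> e != 0 ->
    A i0 i2 = g * c -> A i1 i2 = g * z -> B i0 i2 = g * c -> B i1 i2 = g * z ->
    (forall i j, (e %| A i j - B i j)%Z) ->
    w1 A = w1 B -> w2 A = w2 B ->
    (A i0 i1 %/ (c * e) = B i0 i1 %/ (c * e))%Z ->
    (A i0 i0 %/ (c * e) = B i0 i0 %/ (c * e))%Z ->
    (A i2 i2 %/ (g * c) = B i2 i2 %/ (g * c))%Z ->
    (forall j, (e %| j)%Z -> v1 A - v1 B = j * w1 A -> v2 A - v2 B = j * w2 A -> j = 0) ->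
  A = B.
Proof.
move=> dA dB g0 c0 cz e0 Ac Az Bc Bz eAB; rewrite /w1 /w2 /v1 /v2 Ac Az Bc Bz.
move=> ew1 ew2 eb ea ep jP.
have [eqb eqy] : A i0 i1 = B i0 i1 /\ A i1 i1 = B i1 i1.
  apply: (line_inj cz c0 e0 (eAB _ _) (eAB _ _) _ eb).
  apply: (mulfI g0).
  have E t s : g * (t * z - c * s) = t * (g * z) - g * c * s by ring.
  by rewrite !E.
have [eqa eqx] : A i0 i0 = B i0 i0 /\ A i1 i0 = B i1 i0.
  apply: (line_inj cz c0 e0 (eAB _ _) (eAB _ _) _ ea).
  apply: (mulfI (_ : - g != 0)); first by rewrite oppr_eq0.
  have E t s : - g * (t * z - c * s) = g * c * s - t * (g * z) by ring.
  by rewrite !E.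
(* The first two rows now agree; [d] is the difference of the third rows. *)
pose d k := A i2 k - B i2 k.
have ed k : (e %| d k)%Z by apply: eAB.
have dE k : B i2 k = A i2 k - d k by rewrite /d; ring.
clearbody d.
move: dA dB; rewrite !det3 Bc Bz Ac Az -eqa -eqb -eqx -eqy !dE => dA dB.
set a := A i0 i0 in jP dA dB *; set b := A i0 i1 in jP dA dB *.
set x := A i1 i0 in jP dA dB *; set y := A i1 i1 in jP dA dB *.
set p1 := A i2 i0 in jP dA dB *; set p2 := A i2 i1 in jP dA dB *.
set p3 := A i2 i2 in jP dA dB *.
(* Equal determinants make [d] orthogonal to the cross product of the first two rows. *)
have dw : d i0 * (b * (g * z) - (g * c) * y) + d i1 * ((g * c) * x - a * (g * z))
          + d i2 * (a * y - b * x) = 0.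
  by move: dA; rewrite -dB; move/eqP; rewrite -subr_eq0 => /eqP <-; ring.
(* Cramer's rule in the basis of the rows of [A]: [i] and [j] are the coordinates of [d] along the
   first two rows, and the third coordinate vanishes by [dw]. *)
pose i := d i0 * (y * p3 - (g * z) * p2) + d i1 * ((g * z) * p1 - x * p3)
          + d i2 * (x * p2 - y * p1).
pose j := d i0 * (p2 * (g * c) - p3 * b) + d i1 * (p3 * a - p1 * (g * c))
          + d i2 * (p1 * b - p2 * a).
have d0E : d i0 = i * a + j * x.
  rewrite -[LHS]mulr1 -dA; apply/eqP; rewrite -subr_eq0; apply/eqP.
  by rewrite -[RHS](mulr0 p1) -dw /i /j; ring.
have d1E : d i1 = i * b + j * y.
  rewrite -[LHS]mulr1 -dA; apply/eqP; rewrite -subr_eq0; apply/eqP.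
  by rewrite -[RHS](mulr0 p2) -dw /i /j; ring.
have d2E : d i2 = i * (g * c) + j * (g * z).
  rewrite -[LHS]mulr1 -dA; apply/eqP; rewrite -subr_eq0; apply/eqP.
  by rewrite -[RHS](mulr0 p3) -dw /i /j; ring.
have ej : (e %| j)%Z by rewrite /j !rpredD ?dvdz_mulr.
(* Subtracting [d] from the third row changes [v1] and [v2] by [j] times [w1] and [w2], which is the
   situation treated by [jP]. *)
have j0 : j = 0.
  apply: jP => //; rewrite !dE -?/p1 -?/p2 -?/p3 -?eqa -?eqb -?/a -?/b.
    by rewrite d1E d2E; ring.
  by rewrite d0E d2E; ring.
(* With [j = 0] the last entry of [d] is [i * (g * c)], so the quotient code of [A i2 i2] forces
   [i = 0]. *)
have eqp : p3 = p3 - d i2.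
  apply: (@divz_inj (g * c)); first by rewrite mulf_neq0.
    by rewrite d2E j0 mul0r addr0 subKr dvdz_mull.
  by rewrite /p3 ep dE.
have dk2 : d i2 = 0 by rewrite -(subKr p3 (d i2)) -eqp subrr.
have ii0 : i = 0.
  move: dk2; rewrite d2E j0 mul0r addr0 => /eqP.
  by rewrite !mulf_eq0 (negPf g0) (negPf c0) !orbF => /eqP.
have dk0 : d i0 = 0 by rewrite d0E ii0 j0 !mul0r addr0.
have dk1 : d i1 = 0 by rewrite d1E ii0 j0 !mul0r addr0.
apply/matrixP => k l; case: (I3P k) => ->; case: (I3P l) => ->;
  by rewrite ?Ac ?Bc ?Az ?Bz ?dE ?dk0 ?dk1 ?dk2 ?subr0.
Qed.

(** * Counting matrices with a dominant corner entry *)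

(** As the determinant is 1, [adj3 A] is the inverse; the corner entry stands in for the norm of
    [A], to which it is comparable up to [K]. *)
Definition pivoted (K T : nat) (A : 'M[int]_3) : Prop :=
  [/\ \det A = 1, A i0 i2 != 0,
      forall i j, (`|A i j| <= K * `|A i0 i2|)%N &
      forall i j, (`|A i0 i2| * `|adj3 A i j| <= T)%N].

(** The last entry of the identity (r1 x r2) x (r1 x r3) = det(A) r1, where r1, r2, r3 are the rows
    of [A]. *)
Lemma w_v_det (A : 'M[int]_3) : w1 A * v2 A - w2 A * v1 A = A i0 i2 * \det A.
Proof. by rewrite det3 /w1 /w2 /v1 /v2; ring. Qed.

Lemma w_neq0 A : \det A = 1 -> A i0 i2 != 0 -> (w1 A != 0) || (w2 A != 0).
Proof.
move=> dA; apply: contraNT; rewrite negb_or !negbK => /andP[/eqP w10 /eqP w20].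
by move/eqP: (w_v_det A); rewrite w10 w20 dA !mul0r subr0 mulr1 eq_sym.
Qed.

Definition wmax (A : 'M[int]_3) : nat := maxn `|w1 A| `|w2 A|.

(* Given the first two rows, [(v1, v2)] is known modulo [(w1, w2)]; dividing by the
   larger coordinate keeps the code small. *)
Definition coset_code (A : 'M[int]_3) : int :=
  if (`|w2 A| <= `|w1 A|)%N then (v1 A %/ w1 A)%Z else (v2 A %/ w2 A)%Z.

Lemma wmax_gt0 A : \det A = 1 -> A i0 i2 != 0 -> (0 < wmax A)%N.
Proof. by move=> dA c0; have := w_neq0 dA c0; rewrite /wmax; lia. Qed.

Lemma wmax_le K T A : pivoted K T A -> (`|A i0 i2| * wmax A <= T)%N.
Proof.
case=> _ _ _ hT; rewrite /wmax maxnMr geq_max /w1 /w2.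
by have := hT i0 i2; have := hT i1 i2; rewrite !adj3E => -> ->.
Qed.

Lemma v_le K T A : pivoted K T A ->
  (`|A i0 i2| * `|v1 A| <= T)%N /\ (`|A i0 i2| * `|v2 A| <= T)%N.
Proof.
case=> _ _ _ hT; split.
  by have := hT i0 i1; rewrite !adj3E -(abszN (_ - _)); congr (_ * `|_| <= _)%N; rewrite /v1; ring.
by have := hT i1 i1; rewrite !adj3E -(abszN (_ - _)); congr (_ * `|_| <= _)%N; rewrite /v2; ring.
Qed.

(** A quotient v / w is at most |v| / |w| + 1 in size, and the corner entry times either |v| or |w|
    is at most [T]. *)
Lemma coset_code_le K T A : pivoted K T A ->
  (`|A i0 i2| * (wmax A * `|coset_code A|) <= T + T)%N.
Proof.
move=> pA0; have wT := wmax_le pA0; have [dA c0 _ _] := pA0.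
have w0 := wmax_gt0 dA c0.
have [v1T v2T] := v_le pA0.
rewrite /coset_code /wmax in w0 wT *; case: ifP => [le21|/negbT]; last rewrite -ltnNge => lt12.
  rewrite (maxn_idPl le21) in w0 wT *.
  apply: leq_trans (leq_add v1T wT); rewrite -mulnDr leq_mul2l; apply/orP; right.
  by rewrite mulnC divz_bound// -absz_gt0.
rewrite (maxn_idPr (ltnW lt12)) in w0 wT *.
apply: leq_trans (leq_add v2T wT); rewrite -mulnDr leq_mul2l; apply/orP; right.
by rewrite mulnC divz_bound// -absz_gt0.
Qed.

(** All the data that determine [A], except [w1] and [w2]: [kb] and [ka] are positions on the two
    lines of solutions, [i] and [j] locate the third row modulo the lattice of the first two. *)
Definition coded (g c z kb ka i j : int) (A : 'M[int]_3) : Prop :=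
  [/\ \det A = 1, A i0 i2 = g * c /\ A i1 i2 = g * z,
      (A i0 i1 %/ c)%Z = kb /\ (A i0 i0 %/ c)%Z = ka,
      (A i2 i2 %/ (g * c))%Z = i & coset_code A = j].

Lemma absz_max_neq0 (x y : int) : (x != 0) || (y != 0) -> (`|y| <= `|x|)%N -> x != 0.
Proof. by case: eqVneq => // ->; rewrite absz0 leqn0 absz_eq0 => /negPf ->. Qed.

Lemma coded_inj g c z kb ka i j A B :
    g != 0 -> c != 0 -> coprimez c z -> coded g c z kb ka i j A ->
    coded g c z kb ka i j B -> w1 A = w1 B -> w2 A = w2 B ->
  A = B.
Proof.
move=> g0 c0 cz [dA [Ac Az] [Akb Aka] Ai Aj] [dB [Bc Bz] [Bkb Bka] Bi Bj] e1 e2.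
apply: (@pivot_inj 1 g c z) => //; rewrite ?mulr1 ?Akb ?Aka ?Ai//.
move=> k _ ev1 ev2.
have w0 : (w1 A != 0) || (w2 A != 0) by apply: w_neq0; rewrite // Ac mulf_neq0.
have k0 w v v' : w != 0 -> v - v' = k * w -> (v %/ w = v' %/ w)%Z -> k = 0.
  move=> wn0 vk vdiv; have vv : v = v' by apply: (divz_inj wn0); rewrite ?vk ?dvdz_mull.
  by move/esym/eqP: vk; rewrite vv subrr mulf_eq0 (negPf wn0) orbF => /eqP.
(* The divisor in [coset_code] is the larger coordinate of w, hence nonzero, so equal codes leave
   only the multiple 0. *)
move: Bj; rewrite -Aj /coset_code -e1 -e2; case: ifP => le21 ejj.
  exact: (k0 _ _ _ (absz_max_neq0 w0 le21) ev1 (esym ejj)).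
move/negbT: le21; rewrite -ltnNge orbC in w0 * => /ltnW le12.
exact: (k0 _ _ _ (absz_max_neq0 w0 le12) ev2 (esym ejj)).
Qed.

Section Count.
Variable R : realFieldType.

(** Both coordinates of w are multiples of [g]; write w = g u with |u| at most [r]. If [m] does not
    divide [g], the congruence becomes z u1 = c u2 mod [m]. As [c] and [z] are coprime, one of them
    is invertible mod [m], so one coordinate of u is free and the other is known mod [m]. If [m]
    divides [g], both are left free. *)
Lemma atmost_w (m g r : nat) (c z kb ka i j : int) :
    (m = 1 \/ prime m)%N -> (0 < g)%N -> c != 0 -> coprimez c z ->
  atmost (fun A => [/\ coded g c z kb ka i j A, (wmax A <= g * r)%N &
                     (m %| A i1 i2 * w1 A - A i0 i2 * w2 A)%Z])
    (if (m %| g)%N then 9 * r%:R ^+ 2 else 6 * r%:R ^+ 2 / m%:R + 9 * r%:R : R).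
Proof.
move=> m1p g0 c0 cz.
have [->|r0] := posnP r.
  apply: atmost0 => [A [] [dA [Ac Az] _ _ _]|]; last by case: ifP; rewrite !expr0n/= !mulr0 ?mul0r ?addr0.
  rewrite muln0 => w0 _; have := wmax_gt0 dA; rewrite Ac mulf_neq0//; first by lia.
  by rewrite eqz_nat -lt0n.
have m0 : (0 < m)%N by case: m1p => [->//|/prime_gt0].
have gz0 : g%:Z != 0 by rewrite eqz_nat -lt0n.
have w1E A : coded g c z kb ka i j A -> w1 A = g%:Z * (w1 A %/ g)%Z.
  case=> _ [Ac Az] _ _ _; rewrite mulrC divzK// /w1 Ac Az rpredB//.
    by rewrite mulrCA dvdz_mulr.
  by rewrite -mulrA dvdz_mulr.
have w2E A : coded g c z kb ka i j A -> w2 A = g%:Z * (w2 A %/ g)%Z.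
  case=> _ [Ac Az] _ _ _; rewrite mulrC divzK// /w2 Ac Az rpredB//.
    by rewrite -mulrA dvdz_mulr.
  by rewrite mulrCA dvdz_mulr.
have bndE w : (`|(g%:Z * w)%R| <= g * r)%N -> (`|w| <= r)%N by rewrite abszM leq_pmul2l.
have r1 : (1 : R) <= r%:R by rewrite ler1n.
case: ifP => [mg|/negbT mg].
  apply: (@atmost_le _ _ _ ((size (irange r))%:R * ((size (irange r))%:R * 1))).
    by rewrite size_irange -addnn -addn1 !natrD; nra.
  apply: (@atmost_cover_cst _ _ _ _ (fun (l : int) (A : 'M[int]_3) => coded g c z kb ka i j A /\
    (wmax A <= g * r)%N /\ (w1 A %/ g)%Z = l)).
    move=> A [cA wA _]; exists (w1 A %/ g)%Z => //.
    by rewrite mem_irange bndE// -w1E// (leq_trans _ wA) ?leq_maxl.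
  move=> u1 _.
  apply: (@atmost_cover_cst _ _ _ _ (fun (l : int) (A : 'M[int]_3) => coded g c z kb ka i j A /\
    (w1 A %/ g)%Z = u1 /\ (w2 A %/ g)%Z = l)).
    move=> A [cA [wA Au1]]; exists (w2 A %/ g)%Z => //.
    by rewrite mem_irange bndE// -w2E// (leq_trans _ wA) ?leq_maxr.
  move=> u2 _; apply: atmost1 => // A B [cA [A1 A2]] [cB [B1 B2]].
  apply: (coded_inj gz0 c0 cz cA cB); first by rewrite w1E// A1 w1E// B1.
  by rewrite w2E// A2 w2E// B2.
have pm : prime m by case: m1p mg => [->|//]; rewrite dvd1n.
have cop x : (m %| g%:Z * x)%Z -> (m %| x)%Z.
  by rewrite Gauss_dvdzr// /coprimez /gcdz /= eqz_nat -/(coprime _ _) prime_coprime.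
have cong A : coded g c z kb ka i j A -> (m %| A i1 i2 * w1 A - A i0 i2 * w2 A)%Z ->
    (m %| z * (w1 A %/ g)%Z - c * (w2 A %/ g)%Z)%Z.
  move=> cA; rewrite {1}w1E// {1}w2E//; case: (cA) => _ [-> ->] _ _ _ dm.
  by apply/cop/cop; move: dm; congr (_ %| _)%Z; ring.
apply: (@atmost_le _ _ _ ((size (irange r))%:R * ((size (irange (r %/ m).+1))%:R * 1))).
  have rm : (r %/ m)%:R * m%:R <= r%:R :> R by rewrite -natrM ler_nat leq_divM.
  have mm : 0 < m%:R :> R by rewrite ltr0n.
  rewrite -ler_pdivlMr// in rm.
  have E k : k.*2.+1%:R = 2 * k%:R + 1 :> R by rewrite -addn1 natrD -muln2 natrM mulrC.
  have -> : 6 * r%:R ^+ 2 / m%:R = 6 * r%:R * (r%:R / m%:R) :> R by ring.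
  rewrite !size_irange !E -[(r %/ m).+1]addn1 natrD mulr1.
  move: rm; set t := (r %/ m)%:R; set s := r%:R / m%:R => ts.
  have t0 : 0 <= t by rewrite ler0n.
  have rr : 2 * r%:R + 1 <= 3 * r%:R :> R by lra.
  apply: (@le_trans _ _ (3 * r%:R * (2 * s + 3))); last by lra.
  by apply: ler_pM => //; lra.
have dv x y : (m %| x)%Z = false -> (m %| x * y)%Z -> (m %| y)%Z.
  move=> mx; rewrite Gauss_dvdzr//; move: mx; rewrite dvdzE /= => mx.
  by rewrite /coprimez /gcdz /= eqz_nat -/(coprime _ _) prime_coprime// mx.
have mz0 : m%:Z != 0 by rewrite eqz_nat -lt0n.
have divle w : (`|w| <= r)%N -> (`|(w %/ m)%Z| <= (r %/ m).+1)%N.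
  move=> wr; have := divz_bound w mz0; rewrite absz_nat => h.
  by rewrite -ltnS; have := ltn_ceil r m0; nia.
(* If [m] divides [c], then [z] is invertible and u2 determines u1 mod [m]; otherwise u1 determines
   u2. *)
have [mc|mc] := boolP (m %| c)%Z.
  have mz : (m %| z)%Z = false.
    apply/negP => mz; have : (m %| gcdz c z)%Z by rewrite dvdz_gcd mc.
    by rewrite (eqP cz) dvdzE /= dvdn1 => /eqP m1; rewrite m1 in pm.
  have := @atmost_cover_cst R _ _ (irange r) (fun (l : int) (A : 'M[int]_3) => [/\ coded g c z kb ka i j A,
    (wmax A <= g * r)%N, (m %| A i1 i2 * w1 A - A i0 i2 * w2 A)%Z & (w2 A %/ g)%Z = l]) _; apply.
    move=> A [cA wA dA]; exists (w2 A %/ g)%Z => //.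
    by rewrite mem_irange bndE// -w2E// (leq_trans _ wA) ?leq_maxr.
  move=> u2 _.
  have := @atmost_cover_cst R _ _ (irange (r %/ m).+1) (fun (l : int) (A : 'M[int]_3) => [/\ coded g c z kb ka i j A,
    (m %| A i1 i2 * w1 A - A i0 i2 * w2 A)%Z, (w2 A %/ g)%Z = u2 &
    ((w1 A %/ g)%Z %/ m)%Z = l]) 1; apply.
    move=> A [cA wA dA Au2]; exists ((w1 A %/ g)%Z %/ m)%Z => //.
    by rewrite mem_irange divle// bndE// -w1E// (leq_trans _ wA) ?leq_maxl.
  move=> u1 _; apply: atmost1 => // A B [cA dA A2 A1] [cB dB B2 B1].
  apply: (coded_inj gz0 c0 cz cA cB); last by rewrite w2E// A2 w2E// B2.
  rewrite w1E// [RHS]w1E//; congr (_ * _); apply: (divz_inj mz0); last by rewrite A1 B1.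
  apply: (dv z) => //; have := rpredB (cong _ cA dA) (cong _ cB dB).
  by rewrite A2 B2; congr (_ %| _)%Z; ring.
have := @atmost_cover_cst R _ _ (irange r) (fun (l : int) (A : 'M[int]_3) => [/\ coded g c z kb ka i j A,
  (wmax A <= g * r)%N, (m %| A i1 i2 * w1 A - A i0 i2 * w2 A)%Z & (w1 A %/ g)%Z = l]) _; apply.
  move=> A [cA wA dA]; exists (w1 A %/ g)%Z => //.
  by rewrite mem_irange bndE// -w1E// (leq_trans _ wA) ?leq_maxl.
move=> u1 _.
have := @atmost_cover_cst R _ _ (irange (r %/ m).+1) (fun (l : int) (A : 'M[int]_3) => [/\ coded g c z kb ka i j A,
  (m %| A i1 i2 * w1 A - A i0 i2 * w2 A)%Z, (w1 A %/ g)%Z = u1 &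
  ((w2 A %/ g)%Z %/ m)%Z = l]) 1; apply.
  move=> A [cA wA dA Au1]; exists ((w2 A %/ g)%Z %/ m)%Z => //.
  by rewrite mem_irange divle// bndE// -w2E// (leq_trans _ wA) ?leq_maxr.
move=> u2 _; apply: atmost1 => // A B [cA dA A1 A2] [cB dB B1 B2].
apply: (coded_inj gz0 c0 cz cA cB); first by rewrite w1E// A1 w1E// B1.
rewrite w2E// [RHS]w2E//; congr (_ * _); apply: (divz_inj mz0); last by rewrite A2 B2.
apply: (dv c); first exact: negbTE.
have := rpredB (cong _ cB dB) (cong _ cA dA).
by rewrite A1 B1; congr (_ %| _)%Z; ring.
Qed.

End Count.

Section Count.
Variable R : realFieldType.

(** For positive [e], the terms decay at least like 1/j. The factor 3 is 2 for the signs and 1 for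
    [j = 0], which counts like 1 and is absorbed by [1 <= harm R n]. *)
Lemma sum_divn (N n D e : nat) :
    (0 < n)%N -> (n <= N)%N -> (0 < D)%N -> (0 < e)%N ->
  \sum_(j <- irange n) (n %/ (D * maxn 1 `|j|%N))%:R ^+ e
    <= 3 * (n%:R / D%:R) ^+ e * harm R N.
Proof.
move=> n0 nN D0 e0.
have h1 : 1 <= harm R n by exact: harm_ge1.
have nD0 : 0 <= n%:R / D%:R :> R by rewrite divr_ge0.
have term k : (0 < k)%N ->
    (n %/ (D * maxn 1 k))%:R ^+ e <= (n%:R / D%:R) ^+ e * k%:R^-1 :> R.
  move=> k0; rewrite (maxn_idPr k0).
  have k0' : 0 < k%:R :> R by rewrite ltr0n.
  have le1 : (n %/ (D * k))%:R <= n%:R / D%:R * k%:R^-1 :> R.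
    by rewrite -mulrA -invfM ler_pdivlMr -?natrM ?ltr0n ?muln_gt0 ?D0// ler_nat leq_divM.
  apply: le_trans (_ : (n%:R / D%:R * k%:R^-1) ^+ e <= _).
    by rewrite lerXn2r ?nnegrE// mulr_ge0// invr_ge0 ltW.
  rewrite exprMn ler_wpM2l ?exprn_ge0//.
  by apply: ler_iXnr; rewrite // ?invr_ge0 ?invf_le1 ?ler1n// ltW.
rewrite (sum_irange n (fun k => (n %/ (D * maxn 1 k))%:R ^+ e)).
apply: (@le_trans _ _ (3 * (n%:R / D%:R) ^+ e * harm R n)).
  apply: (@le_trans _ _ ((n%:R / D%:R) ^+ e + 2 * ((n%:R / D%:R) ^+ e * harm R n))).
    apply: lerD; first by have := term 1%N isT; rewrite invr1 mulr1.
    rewrite ler_wpM2l// /harm mulr_sumr; apply: ler_sum_nat => k /andP[k0 _].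
    exact: term.
  have : 0 <= (n%:R / D%:R) ^+ e :> R by rewrite exprn_ge0.
  by move: (_ ^+ e) => t; nra.
by rewrite ler_wpM2l ?mulr_ge0 ?exprn_ge0// harm_le.
Qed.

(** Sums a bound for fixed [g] and [c] over all corner entries [g * c] of size at most [B], where
    [g] will be the gcd of the last entries of the first two rows. *)
Lemma sum_pivot_cols (N B : nat) (al be : R) : (B <= N)%N -> 0 <= al -> 0 <= be ->
  \sum_(g <- iota 1 B) \sum_(c <- sint (B %/ g)) (al / (g%:R * `|c|%N%:R) + be)
    <= 2 * (al * harm R N ^+ 2 + be * (B%:R * harm R N)).
Proof.
move=> BN al0 be0; have -> : iota 1 B = index_iota 1 B.+1 by rewrite /index_iota subn1.
have hN := harm_ge0 R N.
apply: (@le_trans _ _ (\sum_(1 <= g < B.+1) 2 * (al * harm R N + be * B%:R) * g%:R^-1)).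
  apply: ler_sum_nat => g /andP[g0 gB].
  have g0' : 0 < g%:R :> R by rewrite ltr0n.
  rewrite (sum_sint _ (fun k => al / (g%:R * k%:R) + be)) big_split /= -!mulrA ler_wpM2l//.
  rewrite mulrDl; apply: lerD.
    apply: (@le_trans _ _ (al * g%:R^-1 * harm R (B %/ g))).
      rewrite /harm mulr_sumr; apply: ler_sum => k _.
      by rewrite invfM mulrA.
    rewrite mulrAC ler_wpM2r ?invr_ge0 ?(ltW g0')// ler_wpM2l// harm_le//.
    by rewrite (leq_trans (leq_div _ _)).
  rewrite sumr_const_nat subn1 /= -[leLHS]mulr_natr -?mulrA ler_wpM2l//.
  by rewrite ler_pdivlMr// -natrM ler_nat leq_divM.
rewrite -mulr_sumr -/(harm R B).
apply: (@le_trans _ _ (2 * (al * harm R N + be * B%:R) * harm R N)).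
  by rewrite ler_wpM2l ?harm_le// mulr_ge0// addr_ge0// mulr_ge0.
by rewrite le_eqVlt; apply/orP; left; apply/eqP; ring.
Qed.

(* [m = 1] counts all matrices, at the cost of [T ^ 2]; a prime [m] saves a factor [m]. *)
Lemma atmost_pivoted (m K T B N : nat) :
    (m = 1 \/ prime m)%N -> (0 < T)%N -> (B <= N)%N -> (T.*2 <= N)%N ->
  atmost (fun A : 'M[int]_3 => [/\ pivoted K T A, (`|A i0 i2| <= B)%N &
           (m %| A i1 i2 * w1 A - A i0 i2 * w2 A)%Z])
    (216 * (K.*2 + 3)%:R ^+ 4 * harm R N ^+ 3 * (T%:R ^+ 2 / m%:R + T%:R * B%:R) : R).
Proof.
move=> m1p T0 BN TN.
have m0 : (0 < m)%N by case: m1p => [->//|/prime_gt0].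
set h := harm R N; set k := (K.*2 + 3)%N.
have h1 : 1 <= h by apply: harm_ge1; lia.
(* [F g c] bounds the number of matrices with data [g] and [c]. The constants 108 = 9 * 3 * 2 ^ 2
   and 54 = 9 * 3 * 2 combine [atmost_w], [sum_divn] and the doubling of [T]. *)
pose F (g c : nat) : R := k%:R ^+ 4 * h * (108 * T%:R ^+ 2 / m%:R / (g%:R * c%:R) + 54 * T%:R).
have FE g c : F g c = k%:R ^+ 4 * h * (108 * T%:R ^+ 2 / m%:R) / (g%:R * c%:R)
                      + k%:R ^+ 4 * h * (54 * T%:R).
  by rewrite /F mulrDr !mulrA.
apply: (@atmost_le _ _ _ (\sum_(g <- iota 1 B) \sum_(c <- sint (B %/ g)) F g `|c|%N)).
  under eq_bigr => g _ do under eq_bigr => c _ do rewrite FE.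
  apply: le_trans (sum_pivot_cols BN _ _) _; rewrite -/h.
  - by rewrite !mulr_ge0 ?invr_ge0 ?exprn_ge0 ?(le_trans _ h1).
  - by rewrite !mulr_ge0 ?exprn_ge0 ?(le_trans _ h1).
  have -> : 2 * (k%:R ^+ 4 * h * (108 * T%:R ^+ 2 / m%:R) * h ^+ 2 +
       k%:R ^+ 4 * h * (54 * T%:R) * (B%:R * h)) =
     216 * k%:R ^+ 4 * h ^+ 3 * (T%:R ^+ 2 / m%:R)
       + 108 * k%:R ^+ 4 * h ^+ 2 * (T%:R * B%:R) by ring.
  rewrite mulrDr lerD2l ler_wpM2r ?mulr_ge0//.
  rewrite -[108 * _ * _]mulrA -[216 * _ * _]mulrA; apply: ler_pM => //; first by rewrite !mulr_ge0 ?exprn_ge0 ?(le_trans _ h1).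
    by rewrite ler_nat.
  by rewrite ler_wpM2l ?exprn_ge0//; apply: ler_weXn2l.
pose P (A : 'M[int]_3) := [/\ pivoted K T A, (`|A i0 i2| <= B)%N & (m %| A i1 i2 * w1 A - A i0 i2 * w2 A)%Z].
have gcd_gt0 A : P A -> (0 < gcdn `|A i0 i2| `|A i1 i2|)%N.
  by case=> -[_ c0 _ _] _ _; rewrite gcdn_gt0 absz_gt0 c0.
(* The nested covers fix in turn the gcd [g], then [c] and [z], the positions of the first row's
   entries on their lines, the quotient of [A i2 i2], and the coset code; [atmost_w] then counts
   w. *)
apply: (@atmost_cover _ _ _ _ (fun (g : nat) (A : 'M[int]_3) => P A /\ gcdz (A i0 i2) (A i1 i2) = g%:Z)).
  move=> A PA; exists (gcdn `|A i0 i2| `|A i1 i2|) => //.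
  rewrite mem_iota gcd_gt0//= add1n ltnS.
  case: PA => -[_ c0 _ _] cB _; apply: leq_trans cB.
  by apply: dvdn_leq; rewrite ?absz_gt0// dvdn_gcdl.
move=> g; rewrite mem_iota => /andP[g0 _].
have gz0 : g%:Z != 0 by rewrite eqz_nat -lt0n.
apply: (@atmost_cover _ _ _ _ (fun (c : int) (A : 'M[int]_3) => [/\ P A, A i0 i2 = g%:Z * c &
    exists2 z, A i1 i2 = g%:Z * z & coprimez c z])).
  move=> A [PA gA]; exists (A i0 i2 %/ g)%Z.
    rewrite mem_sint absz_gt0.
    have e : (A i0 i2 %/ g)%Z * g = A i0 i2 by rewrite divzK// -gA dvdz_gcdl.
    case: PA => -[_ c0 _ _] cB _; move: c0 cB; rewrite -{1 2}e mulf_eq0 negb_or => /andP[-> _].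
    by rewrite abszM absz_nat => cB; rewrite leq_divRL.
  split=> //; first by rewrite mulrC divzK// -gA dvdz_gcdl.
  exists (A i1 i2 %/ g)%Z; first by rewrite mulrC divzK// -gA dvdz_gcdr.
  have := mulz_gcdr g%:Z (A i0 i2 %/ g)%Z (A i1 i2 %/ g)%Z.
  rewrite absz_nat [g%:Z * (A i0 i2 %/ g)%Z]mulrC [g%:Z * (A i1 i2 %/ g)%Z]mulrC.
  rewrite !divzK -?gA ?dvdz_gcdl ?dvdz_gcdr// gA => /eqP.
  by rewrite -[X in _ == X]mulr1 (inj_eq (mulfI gz0)).
move=> c; rewrite mem_sint absz_gt0 => /andP[c0 cB].
have c0n : (0 < `|c|)%N by rewrite absz_gt0.
(* Sum over the coset code [j] of the bound for w; [jle] below shows that [wmax A] is at most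
   [g * r]. *)
pose J : R := \sum_(j <- irange T.*2)
  (let r := (T.*2 %/ (g * (g * `|c|) * maxn 1 `|j|%N))%N in
   if (m %| g)%N then 9 * r%:R ^+ 2 else 6 * r%:R ^+ 2 / m%:R + 9 * r%:R).
have J_le : k%:R * `|c|%:R * (k%:R * g%:R * (k%:R * g%:R * (k%:R * J))) <= F g `|c|%N.
  have D0 : (0 < g * (g * `|c|))%N by rewrite !muln_gt0 g0.
  have T20 : (0 < T.*2)%N by rewrite double_gt0.
  have s1 := sum_divn T20 TN D0 (isT : 0 < 1)%N.
  have s2 := sum_divn T20 TN D0 (isT : 0 < 2)%N.
  rewrite -/h in s1 s2.
  have [gr cr mr] : [/\ g%:R != 0 :> R, `|c|%:R != 0 :> R & m%:R != 0 :> R].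
    by rewrite !pnatr_eq0 -!lt0n.
  have mr0 : 0 < m%:R :> R by rewrite ltr0n.
  have gr0 : 0 < g%:R :> R by rewrite ltr0n.
  have cr0 : 0 < `|c|%:R :> R by rewrite ltr0n.
  have DE : (T.*2)%:R / (g * (g * `|c|))%:R = 2 * T%:R / (g%:R ^+ 2 * `|c|%:R) :> R.
    by rewrite -muln2 !natrM; field; rewrite gr cr.
  rewrite DE in s1 s2.
  have -> : k%:R * `|c|%:R * (k%:R * g%:R * (k%:R * g%:R * (k%:R * J))) =
      k%:R ^+ 4 * (g%:R ^+ 2 * `|c|%:R * J) by ring.
  rewrite /F -[k%:R ^+ 4 * h * _]mulrA ler_wpM2l ?exprn_ge0//.
  rewrite /J; case: (boolP (m %| g)%N) => mg /=.
    rewrite -mulr_sumr.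
    apply: (@le_trans _ _ (g%:R ^+ 2 * `|c|%:R * (9 * (3 * (2 * T%:R / (g%:R ^+ 2 * `|c|%:R)) ^+ 2 * h)))).
      by rewrite ler_wpM2l ?ler_wpM2l ?mulr_ge0 ?exprn_ge0.
    have -> : g%:R ^+ 2 * `|c|%:R * (9 * (3 * (2 * T%:R / (g%:R ^+ 2 * `|c|%:R)) ^+ 2 * h)) =
        h * (108 * T%:R ^+ 2 / g%:R / (g%:R * `|c|%:R)) by field; rewrite gr cr.
    (* When [m] divides [g], the congruence gave nothing, but the spare factor 1/g is at most
       1/m. *)
    rewrite ler_wpM2l ?(le_trans _ h1)// -[leLHS]addr0 lerD ?mulr_ge0//.
    rewrite ler_wpM2r ?invr_ge0 ?mulr_ge0// ler_wpM2l ?mulr_ge0 ?exprn_ge0//.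
    by rewrite lef_pV2 ?posrE// ler_nat dvdn_leq.
  rewrite big_split /= -!mulr_sumr -mulr_suml -mulr_sumr.
  apply: (@le_trans _ _ (g%:R ^+ 2 * `|c|%:R * (6 * (3 * (2 * T%:R / (g%:R ^+ 2 * `|c|%:R)) ^+ 2 * h) / m%:R
     + 9 * (3 * (2 * T%:R / (g%:R ^+ 2 * `|c|%:R)) ^+ 1 * h)))).
    rewrite ler_wpM2l ?mulr_ge0 ?exprn_ge0//; apply: lerD.
      by rewrite ler_wpM2r ?invr_ge0 ?ler_wpM2l// ltW.
    by rewrite ler_wpM2l.
  have -> : g%:R ^+ 2 * `|c|%:R * (6 * (3 * (2 * T%:R / (g%:R ^+ 2 * `|c|%:R)) ^+ 2 * h) / m%:R
     + 9 * (3 * (2 * T%:R / (g%:R ^+ 2 * `|c|%:R)) ^+ 1 * h)) =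
      h * (72 * T%:R ^+ 2 / m%:R / (g%:R * `|c|%:R) / g%:R + 54 * T%:R).
    by field; rewrite gr cr mr.
  rewrite ler_wpM2l ?(le_trans _ h1)// lerD2r.
  rewrite ler_pdivrMr//.
  have x0 : 0 <= T%:R ^+ 2 / m%:R / (g%:R * `|c|%:R) :> R.
    by rewrite divr_ge0 ?divr_ge0 ?exprn_ge0 ?mulr_ge0.
  have g1 : 1 <= g%:R :> R by rewrite ler1n.
  have E (n : R) : n * T%:R ^+ 2 / m%:R / (g%:R * `|c|%:R) =
    n * (T%:R ^+ 2 / m%:R / (g%:R * `|c|%:R)) by rewrite !mulrA.
  rewrite !E; apply: (@le_trans _ _ (108 * (T%:R ^+ 2 / m%:R / (g%:R * `|c|%:R)))).
    by rewrite ler_wpM2r// ler_nat.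
  by rewrite ler_peMr// mulr_ge0.
apply: (@atmost_le _ _ _ ((size (irange (K * `|c|)))%:R * ((size (irange (K * g).+1))%:R *
  ((size (irange (K * g).+1))%:R * ((size (irange K.+1))%:R * J))))).
  have szle n k' : (n.*2.+1 <= k')%N -> (size (irange n))%:R <= k'%:R :> R.
    by rewrite size_irange ler_nat.
  have J0 : 0 <= J.
    by apply: sumr_ge0 => l _ /=; case: ifP => _; rewrite ?addr_ge0 ?mulr_ge0 ?exprn_ge0 ?invr_ge0.
  have z_le : (size (irange (K * `|c|)))%:R <= k%:R * `|c|%:R :> R.
    by rewrite -natrM szle// /k; nia.
  have a_le : (size (irange (K * g).+1))%:R <= k%:R * g%:R :> R.
    by rewrite -natrM szle// /k; nia.
  have i_le : (size (irange K.+1))%:R <= k%:R :> R.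
    by rewrite szle// /k; lia.
  apply: (@le_trans _ _ (k%:R * `|c|%:R * (k%:R * g%:R * (k%:R * g%:R * (k%:R * J))))).
    by repeat (apply: ler_pM; rewrite ?mulr_ge0//).
  exact: J_le.
pose Q1 z A := [/\ P A, A i0 i2 = g%:Z * c, A i1 i2 = g%:Z * z & coprimez c z].
apply: (@atmost_cover_cst _ _ _ _ Q1).
  move=> A [PA Ac [z Az cz]]; exists z => //; rewrite mem_irange.
  case: PA => -[_ _ /(_ i1 i2) hK _] _ _; move: hK; rewrite Ac Az !abszM absz_nat.
  by rewrite mulnCA leq_pmul2l.
move=> z _.
pose Q2 kb A := Q1 z A /\ (A i0 i1 %/ c)%Z = kb.
have divle A l : Q1 z A -> (`|(A i0 l %/ c)%Z| <= (K * g).+1)%N.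
  case=> -[] [_ _ /(_ i0 l) hK _] _ _ Ac _ _; move: hK; rewrite Ac abszM absz_nat mulnA => hK.
  rewrite -(leq_pmul2r c0n) mulSn addnC; apply: leq_trans (divz_bound _ c0) _.
  by rewrite leq_add2r.
apply: (@atmost_cover_cst _ _ _ _ Q2).
  by move=> A QA; exists (A i0 i1 %/ c)%Z => //; rewrite mem_irange divle.
move=> kb _.
pose Q3 ka A := Q2 kb A /\ (A i0 i0 %/ c)%Z = ka.
apply: (@atmost_cover_cst _ _ _ _ Q3).
  by move=> A QA; exists (A i0 i0 %/ c)%Z => //; rewrite mem_irange divle//; case: QA.
move=> ka _.
pose Q4 i A := Q3 ka A /\ (A i2 i2 %/ (g%:Z * c))%Z = i.
have gc0 : g%:Z * c != 0 by rewrite mulf_neq0 ?gz0// -absz_gt0.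
apply: (@atmost_cover_cst _ _ _ _ Q4).
  move=> A QA; exists (A i2 i2 %/ (g%:Z * c))%Z => //; rewrite mem_irange.
  case: QA => -[] [] [[_ _ /(_ i2 i2) hK _] _ _] Ac _ _ _ _; move: hK; rewrite Ac => hK.
  rewrite -(@leq_pmul2r `|(g%:Z * c)%R|) ?absz_gt0// mulSn addnC.
  by apply: leq_trans (divz_bound _ gc0) _; rewrite leq_add2r.
move=> i _.
pose Q5 j A := Q4 i A /\ coset_code A = j.
have jle A : Q4 i A -> (g * (g * `|c|) * (maxn 1 `|coset_code A| * (wmax A %/ g)) <= T.*2)%N.
  case=> -[] [] [[pA _ _] Ac Az cz] _ _ _.
  have := coset_code_le pA; have := wmax_le pA; rewrite Ac abszM absz_nat addnn => hw hj.
  have gw := leq_divM (wmax A) g.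
  have mj : (g * `|c| * (wmax A * maxn 1 `|coset_code A|) <= T.*2)%N.
    rewrite maxnMr muln1 maxnMr geq_max hj andbT (leq_trans hw)// -addnn leq_addr //.
  apply: leq_trans mj.
  move: gw; set M := maxn _ _; set w := (wmax A %/ g)%N => gw.
  have -> : (g * (g * `|c|) * (M * w) = g * `|c| * (w * g * M))%N by ring.
  by rewrite leq_mul2l leq_mul2r gw !orbT.
have wdvd A : Q4 i A -> wmax A = (g * (wmax A %/ g))%N.
  case=> -[] [] [_ Ac Az _] _ _ _; rewrite mulnC divnK// /wmax.
  have d1 : (g %| `|w1 A|)%N.
    rewrite -[g]absz_nat -dvdzE /w1 Ac Az rpredB//; first by rewrite mulrCA dvdz_mulr.
    by rewrite -mulrA dvdz_mulr.
  have d2 : (g %| `|w2 A|)%N.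
    rewrite -[g]absz_nat -dvdzE /w2 Ac Az rpredB//; last by rewrite mulrCA dvdz_mulr.
    by rewrite -mulrA dvdz_mulr.
  by rewrite /maxn; case: ifP.
have c0' : c != 0 by rewrite -absz_gt0.
have w_gt0 A : Q4 i A -> (0 < wmax A)%N.
  by case=> -[] [] [[[dA cA _ _] _ _] _ _ _] _ _ _; apply: wmax_gt0.
apply: (@atmost_cover _ _ _ _ Q5).
  move=> A QA; exists (coset_code A) => //; rewrite mem_irange.
  apply: leq_trans (jle _ QA); rewrite mulnCA -[leqLHS]muln1 leq_mul ?leq_max ?leqnn ?orbT//.
  rewrite !muln_gt0 g0 c0n /=; have := w_gt0 _ QA; rewrite {1}(wdvd _ QA) muln_gt0.
  by case/andP.
move=> j _; case: (boolP (coprimez c z)) => [cz|ncz]; last first.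
  apply: atmost0 => [A [] [] [] [] [] //|]; first by rewrite (negbTE ncz).
  by case: (m %| g)%N; rewrite ?addr_ge0 ?mulr_ge0 ?exprn_ge0 ?invr_ge0.
apply: atmost_sub (@atmost_w R m g _ c z kb ka i j m1p g0 c0' cz) => A [QA jA].
split.
- by case: QA => -[] [] [[[dA _ _ _] _ _] Ac Az _] kbA kaA iA.
- rewrite wdvd// leq_pmul2l// leq_divRL; last by rewrite !muln_gt0 g0 c0n leq_max.
  by rewrite mulnC -mulnA -jA; have := jle _ QA; rewrite -!mulnA.
- by case: QA => -[] [] [[_ _ ?] _ _ _].
Qed.
End Count.

(** * Matrices that are scalar modulo q *)

Lemma intr_Fp_eq0 (q : nat) (x : int) : prime q -> ((x%:~R : 'F_q) == 0) = (q %| x)%Z.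
Proof.
move=> pq; rewrite dvdzE absz_nat (dvdn_pcharf (pchar_Fp pq)).
by case: x => n //; rewrite NegzE abszN absz_nat mulrNz oppr_eq0.
Qed.

(** For determinant 1 the adjugate is an involution, so the corner entry is a 2 by 2 minor of
    [adj3 A]; each of its two products, times the square of the corner, is at most [T ^ 2]. *)
Lemma pivoted_cube K T A : pivoted K T A -> (`|A i0 i2| ^ 3 <= 2 * T ^ 2)%N.
Proof.
case=> dA _ _ hT.
have cE : A i0 i2 = adj3 A i0 i1 * adj3 A i1 i2 - adj3 A i0 i2 * adj3 A i1 i1.
  by rewrite -[LHS]mulr1 -dA det3 !adj3E; ring.
have le1 i j k l : (`|A i0 i2| * `|A i0 i2| * (`|(adj3 A i j * adj3 A k l)%R|) <= T ^ 2)%N.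
  by rewrite abszM mulnACA -mulnn leq_mul.
apply: (@leq_trans (`|A i0 i2| * `|A i0 i2| *
  (`|(adj3 A i0 i1 * adj3 A i1 i2)%R| + `|(adj3 A i0 i2 * adj3 A i1 i1)%R|))).
  by rewrite !expnS expn0 muln1 mulnA leq_mul2l {3}cE orbC; apply/orP; left; lia.
by rewrite mulnDr mul2n -addnn leq_add.
Qed.

Lemma leq_abszB (x y : int) : (`|(x - y)%R| <= `|x| + `|y|)%N.
Proof. lia. Qed.

Lemma eq_of_dvdz_small (q u v : int) : (q %| u - v)%Z -> (`|u - v| < `|q|)%N -> u = v.
Proof.
move=> /dvdzP[k]; move: (u - v) (subrK v u) => d <- ->; rewrite abszM.
case: (eqVneq k 0) => [-> _|k0]; first by rewrite mul0r add0r.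
by rewrite ltnNge leq_pmull// absz_gt0.
Qed.

Section Scalar.
Variable R : realFieldType.

(** Fixing the residue class mod [q] makes all entries of two matrices congruent, so the lines have
    steps [c * q]. The hypothesis [T.*2 < q ^ 3] then forces w and the coset of the third row to
    agree, since their differences are multiples of [q] smaller than [q]. *)
Lemma atmost_scalar (q K T : nat) : prime q -> (0 < T)%N -> (T.*2 < q ^ 3)%N ->
  atmost (fun A => pivoted K T A /\ exists s, redmod q A = s%:M)
    (6 * (K.*2 + 3)%:R ^+ 4 * T%:R : R).
Proof.
move=> pq T0 Tq; set k := (K.*2 + 3)%N.
have q0 := prime_gt0 pq.
have qz0 : q%:Z != 0 by rewrite eqz_nat -lt0n.
(* [M] is the largest size of the corner entry divided by [q] that [pivoted_cube] allows. *)
have exM : exists n, ((q * n) ^ 3 <= 2 * T ^ 2)%N by exists 0%N; rewrite muln0.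
have ubM n : ((q * n) ^ 3 <= 2 * T ^ 2)%N -> (n <= 2 * T ^ 2)%N.
  apply: leq_trans; apply: leq_trans (leq_pmull n q0) _.
  by have [->|n0] := posnP (q * n)%N; rewrite // -[leqLHS]expn1 leq_pexp2l.
have [M Mle Mmax] := ex_maxnP exM ubM.
have Fq j : (q %| j)%Z = ((j%:~R : 'F_q) == 0) by rewrite intr_Fp_eq0.
have entry A (s : 'F_q) i j : redmod q A = s%:M -> (A i j)%:~R = s *+ (i == j) :> 'F_q.
  by move=> /matrixP/(_ i j); rewrite !mxE.
(* A scalar residue [s] has [s ^+ 3 = 1], by taking determinants; hence at most three classes. *)
pose L : seq 'F_q := [seq s <- enum 'F_q | s ^+ 3 == 1].
have inFq (s : 'F_q) : s ^+ 3 = 1 -> s \in L.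
  by move=> s3; rewrite mem_filter s3 eqxx mem_enum.
have size3 : (size L <= 3)%N.
  have uL : uniq L := filter_uniq _ (enum_uniq _).
  have aL : all (root ('X^3 - 1%:P : {poly 'F_q})) L.
    by apply/allP => s; rewrite mem_filter rootE !hornerE => /andP[/eqP -> _]; rewrite subrr.
  have := max_poly_roots _ aL uL; rewrite size_XnsubC//; apply.
  by rewrite -size_poly_eq0 size_XnsubC.
apply: (@atmost_le _ _ _ (3 * (\sum_(g <- iota 1 M) \sum_(c <- sint (M %/ g))
    (k%:R ^+ 4 * (g ^ 2 * `|c|)%:R)))).
  (* From [(q * M) ^ 3 <= 2 * T ^ 2] and [2 * T < q ^ 3]. *)
  have MT : (M ^ 3 <= T)%N.
    rewrite -(@leq_pmul2l (q ^ 3)) ?expn_gt0 ?q0// -expnMn (leq_trans Mle)//.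
    by rewrite -mulnn mulnA leq_mul2r mul2n ltnW ?orbT.
  rewrite (_ : 6 * k%:R ^+ 4 * T%:R = 3 * (k%:R ^+ 4 * (2 * T%:R))); last by ring.
  rewrite ler_wpM2l//; under eq_bigr do rewrite -mulr_sumr.
  rewrite -mulr_sumr ler_wpM2l ?exprn_ge0//.
  have -> : iota 1 M = index_iota 1 M.+1 by rewrite /index_iota subn1.
  apply: (@le_trans _ _ (\sum_(1 <= g < M.+1) 2 * (M ^ 2)%:R)).
    apply: ler_sum_nat => g /andP[g0 gM].
    rewrite (sum_sint _ (fun c => (g ^ 2 * c)%:R)) ler_wpM2l//.
    apply: (@le_trans _ _ (\sum_(1 <= c < (M %/ g).+1) (g * M)%:R)).
      apply: ler_sum_nat => c /andP[_ cM]; rewrite ler_nat -mulnn -mulnA leq_mul2l.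
      by apply/orP; right; rewrite mulnC -leq_divRL.
    rewrite sumr_const_nat subn1 /= -mulrnA ler_nat mulnAC -mulnn leq_mul2r mulnC.
    by rewrite leq_divM orbT.
  rewrite sumr_const_nat subn1 /= -mulrnAr -mulrnA ler_wpM2l// ler_nat.
  by rewrite -expnSr.
apply: (@atmost_le _ _ _ ((size L)%:R *
   (\sum_(g <- iota 1 M) \sum_(c <- sint (M %/ g)) (k%:R ^+ 4 * (g ^ 2 * `|c|)%:R)))).
  rewrite ler_wpM2r ?ler_nat//.
  by apply: sumr_ge0 => g _; apply: sumr_ge0 => c _; rewrite mulr_ge0 ?exprn_ge0.
apply: (@atmost_cover_cst _ _ _ L (fun (s : 'F_q) (A : 'M[int]_3) =>
    pivoted K T A /\ redmod q A = s%:M)).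
  move=> A [pA [s As]]; exists s => //; apply: inFq.
  case: pA => dA _ _ _; have : \det (redmod q A) = 1 by rewrite /redmod det_map_mx dA rmorph1.
  by rewrite As det_scalar.
move=> s _; pose P (A : 'M[int]_3) := pivoted K T A /\ redmod q A = s%:M.
have qdvd A : P A -> (q %| A i0 i2)%Z && (q %| A i1 i2)%Z.
  by case=> _ As; rewrite !Fq !(entry _ _ _ _ As) /= mulr0n eqxx.
pose Q1 (g : nat) (A : 'M[int]_3) := P A /\ gcdn `|A i0 i2| `|A i1 i2| = (q * g)%N.
have c_gt0 A : P A -> (0 < `|A i0 i2|)%N by case=> -[_ c0 _ _] _; rewrite absz_gt0.
have cM A n : P A -> `|A i0 i2|%N = (q * n)%N -> (n <= M)%N.
  by move=> [pA _] cn; apply: Mmax; rewrite -cn (pivoted_cube pA).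
apply: (@atmost_cover _ _ _ _ Q1).
  move=> A PA; have c0 := c_gt0 _ PA.
  have qg : (q %| gcdn `|A i0 i2| `|A i1 i2|)%N.
    by have := qdvd _ PA; rewrite !dvdzE dvdn_gcd.
  have G0 : (0 < gcdn `|A i0 i2| `|A i1 i2|)%N by rewrite gcdn_gt0 c0.
  exists (gcdn `|A i0 i2| `|A i1 i2| %/ q)%N; last by split=> //; rewrite mulnC divnK.
  rewrite mem_iota add1n ltnS divn_gt0// dvdn_leq//=.
  have /dvdnP[n cn] : (q %| `|A i0 i2|)%N by apply: dvdn_trans qg (dvdn_gcdl _ _).
  apply: (@leq_trans n); last by apply: (cM _ _ PA); rewrite cn mulnC.
  by rewrite -(leq_pmul2r q0) divnK// -cn dvdn_leq// dvdn_gcdl.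
move=> g; rewrite mem_iota => /andP[g0 _].
have qg0 : (0 < q * g)%N by rewrite muln_gt0 q0.
have qgz0 : (q * g)%N%:Z != 0 by rewrite eqz_nat -lt0n.
pose Q2 (c : int) (A : 'M[int]_3) := [/\ P A, A i0 i2 = (q * g)%N%:Z * c &
    exists2 z, A i1 i2 = (q * g)%N%:Z * z & coprimez c z].
apply: (@atmost_cover _ _ _ _ Q2).
  move=> A [PA gA].
  have gA' : gcdz (A i0 i2) (A i1 i2) = (q * g)%N%:Z by rewrite /gcdz gA.
  have e : (A i0 i2 %/ (q * g)%N)%Z * (q * g)%N = A i0 i2 by rewrite divzK// -gA' dvdz_gcdl.
  exists (A i0 i2 %/ (q * g)%N)%Z.
    rewrite mem_sint absz_gt0; apply/andP; split.
      by have := c_gt0 _ PA; rewrite absz_gt0 -{1}e mulf_eq0 negb_or => /andP[].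
    rewrite leq_divRL// mulnC; apply: (cM _ _ PA).
    by rewrite -{1}e abszM absz_nat mulnC mulnA.
  split=> //; first by rewrite mulrC.
  exists (A i1 i2 %/ (q * g)%N)%Z; first by rewrite mulrC divzK// -gA' dvdz_gcdr.
  have := mulz_gcdr (q * g)%N%:Z (A i0 i2 %/ (q * g)%N)%Z (A i1 i2 %/ (q * g)%N)%Z.
  rewrite absz_nat ![(q * g)%N%:Z * (_ %/ _)%Z]mulrC.
  rewrite !divzK -?gA' ?dvdz_gcdl ?dvdz_gcdr// gA' => /eqP.
  by rewrite -[X in _ == X]mulr1 (inj_eq (mulfI qgz0)).
move=> c; rewrite mem_sint => /andP[c0n cB].
have c0 : c != 0 by rewrite -absz_gt0.
have gc0 : (q * g)%N%:Z * c != 0 by rewrite mulf_neq0.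
have cq0 : c * q != 0 by rewrite mulf_neq0.
have szle n k' : (n.*2.+1 <= k')%N -> (size (irange n))%:R <= k'%:R :> R.
  by rewrite size_irange ler_nat.
apply: (@atmost_le _ _ _ ((size (irange (K * `|c|)))%:R * ((size (irange (K * g).+1))%:R *
  ((size (irange (K * g).+1))%:R * ((size (irange K.+1))%:R * 1))))).
  have z_le : (size (irange (K * `|c|)))%:R <= k%:R * `|c|%:R :> R.
    by rewrite -natrM szle// /k; nia.
  have a_le : (size (irange (K * g).+1))%:R <= k%:R * g%:R :> R.
    by rewrite -natrM szle// /k; nia.
  have i_le : (size (irange K.+1))%:R <= k%:R :> R.
    by rewrite szle// /k; lia.
  apply: (@le_trans _ _ (k%:R * `|c|%:R * (k%:R * g%:R * (k%:R * g%:R * (k%:R * 1))))).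
    by repeat (apply: ler_pM; rewrite ?mulr_ge0//).
  by rewrite natrM natrX le_eqVlt; apply/orP; left; apply/eqP; ring.
pose Q3 z A := [/\ P A, A i0 i2 = (q * g)%N%:Z * c, A i1 i2 = (q * g)%N%:Z * z & coprimez c z].
apply: (@atmost_cover_cst _ _ _ _ Q3).
  move=> A [PA Ac [z Az cz]]; exists z => //; rewrite mem_irange.
  case: PA => -[_ _ /(_ i1 i2) hK _] _; move: hK; rewrite Ac Az !abszM absz_nat.
  by rewrite mulnCA leq_pmul2l.
move=> z _.
have divle A l : Q3 z A -> (`|(A i0 l %/ (c * q))%Z| <= (K * g).+1)%N.
  case=> -[] [_ _ /(_ i0 l) hK _] _ Ac _ _; move: hK; rewrite Ac abszM absz_nat.
  rewrite (_ : K * (q * g * `|c|) = K * g * `|(c * q)%R|)%N; last by rewrite abszM absz_nat; ring.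
  move=> hK; rewrite -(@leq_pmul2r `|(c * q)%R|) ?absz_gt0// mulSn addnC.
  by apply: leq_trans (divz_bound _ cq0) _; rewrite leq_add2r.
pose Q4 kb A := Q3 z A /\ (A i0 i1 %/ (c * q))%Z = kb.
apply: (@atmost_cover_cst _ _ _ _ Q4).
  by move=> A QA; exists (A i0 i1 %/ (c * q))%Z => //; rewrite mem_irange divle.
move=> kb _.
pose Q5 ka A := Q4 kb A /\ (A i0 i0 %/ (c * q))%Z = ka.
apply: (@atmost_cover_cst _ _ _ _ Q5).
  by move=> A QA; exists (A i0 i0 %/ (c * q))%Z => //; rewrite mem_irange divle//; case: QA.
move=> ka _.
pose Q6 i A := Q5 ka A /\ (A i2 i2 %/ ((q * g)%N%:Z * c))%Z = i.
apply: (@atmost_cover_cst _ _ _ _ Q6).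
  move=> A QA; exists (A i2 i2 %/ ((q * g)%N%:Z * c))%Z => //; rewrite mem_irange.
  case: QA => -[] [] [[_ _ /(_ i2 i2) hK _] _] Ac _ _ _ _; move: hK; rewrite Ac => hK.
  rewrite -(@leq_pmul2r `|((q * g)%N%:Z * c)%R|) ?absz_gt0// mulSn addnC.
  by apply: leq_trans (divz_bound _ gc0) _; rewrite leq_add2r.
move=> i _; apply: atmost1 => // A B.
move=> [[[[PA Ac Az cz] Akb] Aka] Ai] [[[[PB Bc Bz _] Bkb] Bka] Bi].
have eAB k1 l : (q %| A k1 l - B k1 l)%Z.
  by rewrite Fq rmorphB /= (entry _ _ _ _ PA.2) (entry _ _ _ _ PB.2) subrr.
have small d n1 n2 : (q ^ 2 * n1 <= T)%N -> (q ^ 2 * n2 <= T)%N -> (`|d| <= n1 + n2)%N -> (`|d| < q)%N.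
  move=> h1 h2 hd; rewrite -(@ltn_pmul2l (q ^ 2)) ?expn_gt0 ?q0// -expnSr.
  apply: leq_ltn_trans Tq; rewrite -addnn; apply: leq_trans (leq_add h1 h2).
  by rewrite -mulnDr leq_mul2l hd orbT.
have qgc x : (`|((q * g)%N%:Z * c)%R| * `|((q * g)%N%:Z * x)%R| <= T)%N -> (q ^ 2 * `|x| <= T)%N.
  rewrite !abszM absz_nat; apply: leq_trans.
  rewrite (_ : q * g * `|c| * (q * g * `|x|) = g * g * `|c| * (q ^ 2 * `|x|))%N; last by ring.
  by rewrite leq_pmull// !muln_gt0 g0.
(* [f] is [w1] or [w2], and [h] its quotient by [q * g]. Each value of [h] is at most [T / q ^ 2] in
   size, so congruent values differ by less than [q] and coincide. *)
have weq (f : 'M[int]_3 -> int) (h : 'M[int]_3 -> int) :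
    (forall X : 'M[int]_3, A i0 i2 = X i0 i2 -> A i1 i2 = X i1 i2 -> f X = (q * g)%N%:Z * h X) ->
    (`|A i0 i2| * `|f A| <= T)%N -> (`|A i0 i2| * `|f B| <= T)%N ->
    (q %| h A - h B)%Z -> f A = f B.
  move=> fh fA fB dh; rewrite !fh ?Bc ?Bz// in fA fB *; congr (_ * _).
  rewrite Ac in fA fB; apply: (eq_of_dvdz_small dh); rewrite absz_nat.
  by apply: (small _ _ _ (qgc _ fA) (qgc _ fB) (leq_abszB _ _)).
have [[dA cA _ hA] [dB cB' _ hB]] := (PA.1, PB.1).
have ew1 : w1 A = w1 B.
  apply: (weq _ (fun X => X i0 i1 * z - c * X i1 i1)).
  - by move=> X Xc Xz; rewrite /w1 -Xc -Xz Ac Az; ring.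
  - by have := hA i0 i2; rewrite !adj3E.
  - by have := hB i0 i2; rewrite !adj3E {1}Bc -Ac.
  rewrite (_ : _ - _ = (A i0 i1 - B i0 i1) * z - c * (A i1 i1 - B i1 i1)); last by ring.
  apply: rpredB; [exact: dvdz_mulr|exact: dvdz_mull].
have ew2 : w2 A = w2 B.
  apply: (weq _ (fun X => c * X i1 i0 - X i0 i0 * z)).
  - by move=> X Xc Xz; rewrite /w2 -Xc -Xz Ac Az; ring.
  - by have := hA i1 i2; rewrite !adj3E.
  - by have := hB i1 i2; rewrite !adj3E {1}Bc -Ac.
  rewrite (_ : _ - _ = c * (A i1 i0 - B i1 i0) - (A i0 i0 - B i0 i0) * z); last by ring.
  apply: rpredB; [exact: dvdz_mull|exact: dvdz_mulr].
apply: (@pivot_inj q (q * g)%N c z) => //; rewrite ?Akb ?Aka ?Ai//.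
(* The corner entry and [w] are nonzero multiples of [q], whence [q ^ 2 * |j| <= 2 * T < q ^ 3]; as
   [q] divides [j], it is 0. *)
have kill j w v v' u : w = (q * g)%N%:Z * u -> w != 0 -> (q %| j)%Z ->
    (`|A i0 i2| * `|v| <= T)%N -> (`|A i0 i2| * `|v'| <= T)%N -> v - v' = j * w -> j = 0.
  move=> wu w0 qj hv hv' jw; apply: (@eq_of_dvdz_small q); rewrite subr0// absz_nat.
  have qA : (q <= `|A i0 i2|)%N.
    by rewrite Ac !abszM !absz_nat -mulnA leq_pmulr// muln_gt0 g0.
  have qw : (q <= `|w|)%N.
    move: w0; rewrite wu mulf_eq0 negb_or => /andP[_ u0].
    by rewrite !abszM !absz_nat -mulnA leq_pmulr// muln_gt0 g0 absz_gt0.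
  have le1 : (q * (`|j| * q) <= T.*2)%N.
    apply: (@leq_trans (`|A i0 i2| * `|(v - v')%R|)).
      by rewrite jw abszM leq_mul// leq_mul2l qw orbT.
    rewrite -addnn; apply: leq_trans (leq_add hv hv').
    by rewrite -mulnDr leq_mul2l leq_abszB orbT.
  rewrite -(@ltn_pmul2l (q ^ 2)) ?expn_gt0 ?q0// -expnSr.
  by apply: leq_ltn_trans Tq; rewrite (_ : q ^ 2 * `|j| = q * (`|j| * q))%N //; ring.
have [vA1 vA2] := v_le PA.1; have [vB1 vB2] := v_le PB.1.
rewrite Bc -Ac in vB1 vB2.
move=> j qj e1 e2; case/orP: (w_neq0 dA cA) => [w0|w0].
  apply: (kill j _ _ _ (A i0 i1 * z - c * A i1 i1) _ w0 qj vA1 vB1 e1).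
  by rewrite /w1 Ac Az; ring.
apply: (kill j _ _ _ (c * A i1 i0 - A i0 i0 * z) _ w0 qj vA2 vB2 e2).
by rewrite /w2 Ac Az; ring.
Qed.
End Scalar.

(** * Conjugating a large entry into the corner *)

(** The boolean turns the shear off; with the permutations of the coordinates this gives the 12
    conjugations. *)
Definition shear (e : int) (b : bool) : 'M[int]_3 := 1%:M + (e *+ b) *: delta_mx i0 i2.

Lemma shearK e b : shear e b *m shear (- e) b = 1%:M.
Proof.
apply/matrixP => i j; rewrite /shear !mxE big_I3 !mxE.
by case: b; case: (I3P i) => ->; case: (I3P j) => ->; rewrite /= ?mulr1n ?mulr0n; ring.
Qed.

Definition conjby (sb : 'S_3 * bool) (A : 'M[int]_3) : 'M[int]_3 :=
  shear 1 sb.2 *m (perm_mx sb.1 *m A *m perm_mx (sb.1^-1)%g) *m shear (-1) sb.2.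

Definition conjl (sb : 'S_3 * bool) := shear 1 sb.2 *m perm_mx sb.1.
Definition conjr (sb : 'S_3 * bool) := perm_mx (sb.1^-1)%g *m shear (-1) sb.2.

Lemma conjbyE sb A : conjby sb A = conjl sb *m A *m conjr sb.
Proof. by rewrite /conjby /conjl /conjr !mulmxA. Qed.

Lemma conjlr sb : conjl sb *m conjr sb = 1%:M.
Proof.
rewrite /conjl /conjr mulmxA -[X in X *m _]mulmxA -perm_mxM mulgV perm_mx1 mulmx1.
exact: shearK.
Qed.

Lemma conjrl sb : conjr sb *m conjl sb = 1%:M.
Proof. exact: mulmx1C (conjlr sb). Qed.

Lemma conjbyM sb A B : conjby sb (A *m B) = conjby sb A *m conjby sb B.
Proof.
rewrite !conjbyE; have := conjrl sb; move: (conjl sb) (conjr sb) => l r rl.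
by rewrite !mulmxA -(mulmxA _ r l) rl mulmx1.
Qed.

Lemma conjby1 sb : conjby sb 1%:M = 1%:M.
Proof. by rewrite conjbyE mulmx1 conjlr. Qed.

Lemma conjby_inj sb : injective (conjby sb).
Proof.
move=> A B; rewrite !conjbyE; have := conjrl sb; move: (conjl sb) (conjr sb) => l r rl.
move=> /(congr1 (fun M => r *m M *m l)).
by rewrite !mulmxA rl !mul1mx -!mulmxA rl !mulmx1.
Qed.

Lemma det_conjby sb A : \det (conjby sb A) = \det A.
Proof.
have h : \det (conjl sb) * \det (conjr sb) = 1 by rewrite -det_mulmx conjlr det1.
by rewrite conjbyE 2!det_mulmx mulrAC h mul1r.
Qed.

Lemma adj3_conjby sb A : \det A = 1 -> adj3 (conjby sb A) = conjby sb (adj3 A).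
Proof.
move=> dA; have uA : conjby sb A \in unitmx by rewrite unitmxE det_conjby dA unitr1.
rewrite -[RHS](mulKmx uA) -conjbyM mul_adj3 dA conjby1 mulmx1.
by rewrite invmx3// det_conjby.
Qed.

(** At the corner this is [B i0 i2] without shear and [B i0 i2 + B i2 i2 - B i0 i0 - B i2 i0] with
    it, so the corner sees every off-diagonal entry and every difference of diagonal entries. *)
Lemma conjby_entry (sb : 'S_3 * bool) (A : 'M[int]_3) i j :
  let B i j := A (sb.1 i) (sb.1 j) in
  conjby sb A i j = B i j + (B i2 j *+ (i == i0) - B i i0 *+ (j == i2)
                - B i2 i0 *+ ((i == i0) && (j == i2))) *+ sb.2.
Proof.
move=> B; rewrite /conjby -row_permE -col_permE /shear !mxE big_I3 !mxE !big_I3 !mxE /B.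
by case: sb.2; case: (I3P i) => ->; case: (I3P j) => ->; rewrite /= ?mulr1n ?mulr0n; ring.
Qed.

Lemma conjby_bound sb (A : 'M[int]_3) (X : nat) :
  (forall i j, (`|A i j| <= X)%N) -> forall i j, (`|conjby sb A i j| <= 4 * X)%N.
Proof.
move=> hA i j; rewrite conjby_entry; set s := sb.1.
have := (hA (s i) (s j), hA (s i2) (s j), hA (s i) (s i0), hA (s i2) (s i0)).
move: (A _ _) (A _ _) (A _ _) (A _ _) => a b c d [[[ha hb] hc] hd].
by case: (i == i0); case: (j == i2); case: sb.2; rewrite /= ?mulr0n ?mulr1n; lia.
Qed.

Lemma perm_pair (i j : 'I_3) : i != j -> exists s : 'S_3, s i0 = i /\ s i2 = j.
Proof.
move=> ij; have jn : tperm i0 i j != i0.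
  by rewrite -(inj_eq (@perm_inj _ (tperm i0 i))) tpermK tpermL eq_sym.
exists (tperm i2 (tperm i0 i j) * tperm i0 i)%g; rewrite !permM; split.
  by rewrite (@tpermD _ i2 _ i0)// tpermL.
by rewrite tpermL tpermK.
Qed.

(* The determinant is at least [0.3 X ^ 3], which forces [X = 1]. *)
Lemma nearly_scalar (A : 'M[int]_3) (X : nat) :
    \det A = 1 -> (exists i j, `|A i j|%N = X) ->
    (forall i j, i != j -> (10 * `|A i j| < X)%N) ->
    (forall i j, (10 * `|(A i i - A j j)%R| <= 3 * X)%N) ->
  A = 1%:M.
Proof.
move=> dA [i [j ijX]] off dg.
have [d dX] : exists k, `|A k k|%N = X.
  by case: (eqVneq i j) ijX => [->|/off]; [exists j|lia].
have dgl k : (7 * X <= 10 * `|A k k|)%N by have := dg k d; lia.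
have dgu k : (10 * `|A k k| <= 13 * X)%N by have := dg k d; lia.
(* In the determinant the diagonal product is at least 0.343 X^3, the three products with one
   diagonal entry are at most 0.013 X^3 each, and the other two at most 0.001 X^3. Hence 0.302 X^3
   <= 1, which gives X < 2. *)
have X1 : X = 1%N.
  have X0 : (0 < X)%N by have := off i0 i1 isT; lia.
  have offM k l k' l' d' : k != l -> k' != l' ->
      (1000 * (`|A d' d'| * (`|A k l| * `|A k' l'|)) <= 13 * X ^ 3)%N.
    move=> kl kl'; have := leq_mul (dgu d') (leq_mul (ltnW (off _ _ kl)) (ltnW (off _ _ kl'))).
    move: (`|A d' d'|)%N (`|A k l|)%N (`|A k' l'|)%N => a b c h.
    rewrite (_ : 1000 * (a * (b * c)) = 10 * a * (10 * b * (10 * c)))%N; last by ring.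
    by apply: leq_trans h _; apply: eq_leq; ring.
  have offM3 k l k' l' k2 l2 : k != l -> k' != l' -> k2 != l2 ->
      (1000 * (`|A k2 l2| * (`|A k l| * `|A k' l'|)) <= X ^ 3)%N.
    move=> kl kl' kl2.
    have := leq_mul (ltnW (off _ _ kl2)) (leq_mul (ltnW (off _ _ kl)) (ltnW (off _ _ kl'))).
    move: (`|A k2 l2|)%N (`|A k l|)%N (`|A k' l'|)%N => a b c h.
    rewrite (_ : 1000 * (a * (b * c)) = 10 * a * (10 * b * (10 * c)))%N; last by ring.
    by apply: leq_trans h _; apply: eq_leq; ring.
  have main : (343 * X ^ 3 <= 1000 * (`|A i0 i0| * (`|A i1 i1| * `|A i2 i2|)))%N.
    have := leq_mul (dgl i0) (leq_mul (dgl i1) (dgl i2)).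
    move: (`|A i0 i0|)%N (`|A i1 i1|)%N (`|A i2 i2|)%N => a b c h.
    rewrite (_ : 1000 * (a * (b * c)) = 10 * a * (10 * b * (10 * c)))%N; last by ring.
    by apply: leq_trans h; apply: eq_leq; ring.
  have t1 := @offM i1 i2 i2 i1 i0 isT isT.
  have t2 := @offM i0 i1 i1 i0 i2 isT isT.
  have t3 := @offM i0 i2 i2 i0 i1 isT isT.
  have t4 := @offM3 i1 i2 i2 i0 i0 i1 isT isT isT.
  have t5 := @offM3 i1 i0 i2 i1 i0 i2 isT isT isT.
  have X3 : (X ^ 3 < 2 ^ 3)%N.
    move: dA main t1 t2 t3 t4 t5; rewrite -!abszM => dA.
    have -> : A i0 i0 * (A i1 i1 * A i2 i2) = 1 + A i0 i0 * (A i1 i2 * A i2 i1)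
      + A i2 i2 * (A i0 i1 * A i1 i0) + A i1 i1 * (A i0 i2 * A i2 i0)
      - A i0 i1 * (A i1 i2 * A i2 i0) - A i0 i2 * (A i1 i0 * A i2 i1).
      by rewrite -dA det3; ring.
    move: (X ^ 3)%N (A i0 i0 * (A i1 i2 * A i2 i1)) (A i2 i2 * (A i0 i1 * A i1 i0))
      (A i1 i1 * (A i0 i2 * A i2 i0)) (A i0 i1 * (A i1 i2 * A i2 i0))
      (A i0 i2 * (A i1 i0 * A i2 i1)).
    by clear; lia.
  by move: X3; rewrite ltn_exp2r//; clear -X0; lia.
have off0 k l : k != l -> A k l = 0 by move=> /off; rewrite X1; lia.
have dgE k l : A k k = A l l by have := dg k l; rewrite X1; lia.
have A1 : A i0 i0 = 1.
  move: dA; rewrite det3 (off0 i0 i1)// (off0 i0 i2)// (off0 i1 i2)// (dgE i1 i0) (dgE i2 i0).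
  rewrite !mul0r !subr0 ?addr0.
  have := dgu i0; rewrite X1 => h; have := dgl i0; rewrite X1 => h'.
  have [->|->] // : A i0 i0 = 1 \/ A i0 i0 = -1 by clear -h h'; lia.
apply/matrixP => k l; rewrite mxE; case: eqVneq => [->|/off0 ->//].
by rewrite (dgE l i0) A1.
Qed.

Definition entries_le (T : nat) (A : 'M[int]_3) : Prop :=
  exists X Y : nat, [/\ forall i j, (`|A i j| <= X)%N,
    forall i j, (`|adj3 A i j| <= Y)%N & (X * Y <= T)%N].

(** Let Z be the largest entry size. If all 12 corners were below Z/10, the off-diagonal entries
    would be below Z/10 and the diagonal differences below 3Z/10, and [nearly_scalar] would give the
    identity. Conjugation enlarges entries at most 4 times, whence 40 = 4 * 10 and 16 = 4 * 4. *)
Lemma conjby_pivoted T A : \det A = 1 -> A <> 1%:M -> entries_le T A ->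
  exists sb, pivoted 40 (16 * T) (conjby sb A).
Proof.
move=> dA A1 [X [Y [hX hY XY]]].
pose Z := (\max_(p : 'I_3 * 'I_3) `|A p.1 p.2|)%N.
have hZ i j : (`|A i j| <= Z)%N by apply: (leq_bigmax (F := fun p => `|A p.1 p.2|%N) (i, j)).
have [i [j ijZ]] : exists i j, `|A i j|%N = Z.
  have I0 : (0 < #|{: 'I_3 * 'I_3}|)%N by rewrite card_prod card_ord.
  by have [[i j] e] := bigop.eq_bigmax (fun p : 'I_3 * 'I_3 => `|A p.1 p.2|%N) I0; exists i, j.
have ZX : (Z <= X)%N by rewrite -ijZ.
have Z0 : (0 < Z)%N.
  rewrite lt0n; apply/eqP => Z0; have A0 k l : A k l = 0 by have := hZ k l; rewrite Z0; lia.
  by move: dA; rewrite det3 !A0 !mul0r ?subr0 ?addr0.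
case: (pselect (exists sb, (Z <= 10 * `|conjby sb A i0 i2|)%N)) => [[sb hsb]|no].
  exists sb; split.
  - by rewrite det_conjby.
  - by rewrite -absz_gt0; lia.
  - by move=> k l; have := conjby_bound sb hZ k l; lia.
  - move=> k l; rewrite adj3_conjby//.
    apply: (@leq_trans ((4 * X) * (4 * Y))); last by nia.
    by rewrite leq_mul// conjby_bound.
have lt sb : (10 * `|conjby sb A i0 i2| < Z)%N.
  by rewrite ltnNge; apply/negP => h; apply: no; exists sb.
have off k l : k != l -> (10 * `|A k l| < Z)%N.
  move=> /perm_pair[s [s0 s2]]; have := lt (s, false).
  by rewrite conjby_entry/= s0 s2 mulr0n addr0.
case: A1; apply: (nearly_scalar dA _ off); first by exists i, j.
move=> k l; have [->|kl] := eqVneq k l; first by rewrite subrr absz0 muln0.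
have [s [s0 s2]] := perm_pair kl; have := lt (s, true).
rewrite conjby_entry /= s0 s2 !mulr1n; have := off _ _ kl; rewrite eq_sym in kl; have := off _ _ kl.
move: (A k l) (A l k) (A k k) (A l l) => a b c d; lia.
Qed.

Lemma atmost_conj (R : realFieldType) (E : 'M[int]_3 -> Prop) (T : nat) (N : R) :
    (forall sb A, \det A = 1 -> E A -> E (conjby sb A)) ->
    atmost (fun A => pivoted 40 (16 * T) A /\ E A) N ->
  atmost (fun A => [/\ \det A = 1, A <> 1%:M, entries_le T A & E A]) (12 * N).
Proof.
move=> EE hN.
have -> : 12 = (size (enum {: 'S_3 * bool}))%:R :> R.
  by rewrite -cardE card_prod card_bool card_Sn.
apply: (@atmost_cover_cst _ _ _ _
   (fun sb A => \det A = 1 /\ E A /\ pivoted 40 (16 * T) (conjby sb A))).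
  move=> A [dA A1 eA EA]; have [sb psb] := conjby_pivoted dA A1 eA.
  by exists sb; rewrite ?mem_enum.
move=> sb _; apply: (@atmost_inj _ _ _ (conjby sb)) hN.
  by move=> A B _ _; exact: conjby_inj.
by move=> A [dA [EA pA]]; split=> //; apply: EE.
Qed.

(* For [\det A = 1] this says that [A] satisfies a quadratic equation mod [q]. *)
Definition derogatory (q : nat) (A : 'M[int]_3) : Prop :=
  exists l mu : 'F_q, redmod q (adj3 A) = l%:M + mu *: redmod q A.

Lemma redmod_conjby q sb A :
  redmod q (conjby sb A) = redmod q (conjl sb) *m redmod q A *m redmod q (conjr sb).
Proof. by rewrite conjbyE /redmod !map_mxM. Qed.

Lemma redmod_conjlr q sb : redmod q (conjl sb) *m redmod q (conjr sb) = 1%:M.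
Proof. by rewrite /redmod -map_mxM conjlr map_mx1. Qed.

Lemma scalar_conjby q sb A :
  (exists s, redmod q A = s%:M) -> exists s, redmod q (conjby sb A) = s%:M.
Proof.
case=> s As; exists s; rewrite redmod_conjby As -scalemx1 -scalemxAr mulmx1.
by rewrite -scalemxAl redmod_conjlr.
Qed.

Lemma derogatory_conjby q sb A : \det A = 1 -> derogatory q A -> derogatory q (conjby sb A).
Proof.
move=> dA [l [mu h]]; exists l, mu; rewrite adj3_conjby// !redmod_conjby h mulmxDr mulmxDl.
by rewrite -[l%:M]scalemx1 -!scalemxAr mulmx1 -!scalemxAl redmod_conjlr.
Qed.

(** [w1] and [w2] are off-diagonal entries of [adj3 A], so mod [q] they are [mu] times [A i0 i2] and
    [A i1 i2]. *)
Lemma derogatory_dvd q A : prime q -> derogatory q A -> (q %| A i1 i2 * w1 A - A i0 i2 * w2 A)%Z.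
Proof.
move=> pq [l [mu /matrixP h]]; rewrite -intr_Fp_eq0// rmorphB !rmorphM /=.
have e1 : (w1 A)%:~R = mu * (A i0 i2)%:~R :> 'F_q.
  have := h i0 i2; rewrite mxE adj3E -/(w1 A) => ->.
  by rewrite !mxE /= mulr0n add0r.
have e2 : (w2 A)%:~R = mu * (A i1 i2)%:~R :> 'F_q.
  have := h i1 i2; rewrite mxE adj3E -/(w2 A) => ->.
  by rewrite !mxE /= mulr0n add0r.
by rewrite e1 e2 mulrCA [X in _ - X]mulrCA [X in mu * X - _]mulrC subrr.
Qed.

(** * Fixed flags *)

Section Subspaces.
Variables (R : realFieldType) (F : finFieldType) (vT : vectType F).
Implicit Types (U V W K I : {vspace vT}).
Local Notation q := (#|F|%:R : R).

Lemma vpick_line U : (\dim U <= 1)%N -> U = <[vpick U]>%VS.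
Proof.
move=> dU; apply/esym/eqP; rewrite eqEdim -memvE memv_pick dim_vline vpick0.
by have [->|U0] := eqVneq U 0%VS; rewrite ?dimv0.
Qed.

(** A line in the span of [e1] and [e2] is spanned by [e2] or by some [e1 + x *: e2]; [option F]
    indexes these. *)
Lemma atmost_lines K : (\dim K <= 2%N)%N ->
  atmost (fun U => \dim U = 1%N /\ (U <= K)%VS) (q + 1).
Proof.
move=> dK; set e1 := vpick K; set e2 := vpick (K :\: <[e1]>)%VS.
have Ke1 : (<[e1]> <= K)%VS by rewrite -memvE memv_pick.
have [K0|K0] := eqVneq K 0%VS.
  apply: atmost0 => [U [dU]|]; last by rewrite addr_ge0.
  by rewrite K0 subv0 => /eqP U0; rewrite U0 dimv0 in dU.
have Kdec : K = (<[e1]> + <[e2]>)%VS.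
  rewrite /e2 -vpick_line.
    by rewrite -{1}(addv_diff_cap K <[e1]>) (capv_idPr Ke1) addvC.
  have := dimv_cap_compl K <[e1]>; rewrite (capv_idPr Ke1) dim_vline vpick0 K0 => h.
  by rewrite -(leq_add2l 1) h.
have -> : q + 1 = (size (enum {: option F}))%:R * 1.
  by rewrite mulr1 -cardE card_option -addn1 natrD.
apply: (@atmost_cover_cst _ _ _ _ (fun (x : option F) U =>
   U = if x is Some x then <[e1 + x *: e2]>%VS else <[e2]>%VS)); last first.
  by move=> x _; apply: atmost1 => // U V -> ->.
move=> U [dU UK]; have uU := memv_pick U.
have := subvP UK _ uU; rewrite {1}Kdec => /memv_addP[y1 /vlineP[a ->] [y2 /vlineP[b ->] uE]].
have UE : U = <[vpick U]>%VS by apply: vpick_line; rewrite dU.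
have U0 : vpick U != 0 by rewrite vpick0 -dimv_eq0 dU.
have lineZ (c : F) (v : vT) : c != 0 -> <[c *: v]>%VS = <[v]>%VS.
  move=> c0; apply/eqP; rewrite eqEsubv -!memvE; apply/andP; split.
    by rewrite memvZ ?memv_line.
  by rewrite -[X in X \in _](scalerK c0) memvZ ?memv_line.
have [a0|a0] := eqVneq a 0.
  exists None; first by rewrite mem_enum.
  rewrite [LHS]UE uE a0 scale0r add0r; apply: lineZ.
  by apply: contraNneq U0 => b0; rewrite uE a0 b0 !scale0r addr0.
exists (Some (a^-1 * b)); first by rewrite mem_enum.
by rewrite [LHS]UE uE -[RHS](lineZ a) // scalerDr scalerA mulrA mulfV// mul1r.
Qed.

(** Intersecting with a complement of [I] turns planes through [I] into lines of that complement,
    injectively. *)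
Lemma atmost_planes I : \dim I = 1%N -> \dim {: vT} = 3%N ->
  atmost (fun W => \dim W = 2%N /\ (I <= W)%VS) (q + 1).
Proof.
move=> dI d3; have dC : \dim (I^C)%VS = 2%N by rewrite dimv_compl d3 dI.
have IW W : \dim W = 2%N -> (I <= W)%VS -> \dim (W :&: I^C)%VS = 1%N /\ W = (I + (W :&: I^C))%VS.
  move=> dW IW; have h := dimv_sum_cap W (I^C)%VS.
  have le3 : (\dim (W + I^C) <= 3%N)%N by rewrite -d3 dimvS ?subvf.
  have dis : (I :&: (W :&: I^C) = 0)%VS.
    by apply/eqP; rewrite -subv0 -(capv_compl I) capvS// capvSr.
  have sub : (I + (W :&: I^C) <= W)%VS by rewrite subv_add IW capvSl.
  have := dimvS sub; rewrite dimv_disjoint_sum// dI dW => le2.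
  have d1 : \dim (W :&: I^C)%VS = 1%N by lia.
  by split=> //; apply/esym/eqP; rewrite eqEdim sub dimv_disjoint_sum// dI dW d1.
apply: (@atmost_inj _ _ _ (fun W => (W :&: I^C)%VS)) (@atmost_lines (I^C)%VS _).
- move=> W W' [dW sW] [dW' sW'] e.
  by rewrite (IW _ dW sW).2 (IW _ dW' sW').2 e.
- by move=> W [dW sW]; rewrite capvSr (IW _ dW sW).1.
- by rewrite dC.
Qed.

End Subspaces.

Section Flags.
Variables (R : realFieldType) (F : finFieldType).
Local Notation q := (#|F|%:R : R).
Local Notation vT := 'cV[F]_3.
Implicit Types (V W : flag F).

Lemma flagP V : [/\ ((val V).1 <= (val V).2)%VS, \dim (val V).1 = 1%N & \dim (val V).2 = 2].
Proof. by case: V => -[V1 V2] /= /and3P[/= ? /eqP ? /eqP ?]. Qed.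

Lemma dim_col3 : \dim {: vT} = 3%N.
Proof. by rewrite dimvf /dim /= muln1. Qed.

Lemma flag_eq V W : (val V).1 = (val W).1 -> (val V).2 = (val W).2 -> V = W.
Proof.
move=> e1 e2; apply: val_inj; move: e1 e2.
by case: (val V) (val W) => [V1 V2] [W1 W2] /= -> ->.
Qed.

Lemma card_ge1 : 1 <= q.
Proof. by rewrite ler1n; apply/card_gt0P; exists 0. Qed.

Lemma dim_line (v : vT) : v != 0 -> \dim <[v]>%VS = 1%N.
Proof. by rewrite dim_vline => ->. Qed.

Lemma dim_line_join (U I : {vspace vT}) :
  \dim U = 1%N -> \dim I = 1%N -> U != I -> \dim (U + I)%VS = 2%N.
Proof.
move=> dU dI UI; rewrite dimv_disjoint_sum ?dU ?dI//.
apply/eqP; rewrite -dimv_eq0 -leqn0 -ltnS.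
have le1 : (\dim (U :&: I) <= 1)%N by apply: leq_trans (dimvS (capvSl U I)) _; rewrite dU.
rewrite ltn_neqAle le1 andbT; apply: contra UI => /eqP d1.
have UE : (U :&: I)%VS = U by apply/eqP; rewrite eqEdim capvSl d1 dU.
have IE : (U :&: I)%VS = I by apply/eqP; rewrite eqEdim capvSr d1 dI.
by rewrite -UE IE.
Qed.

(** Lines other than a fixed [I] are counted through their joins with [I], which are planes through
    [I]; each line then lies in at most q + 1 planes. *)
Lemma atmost_flags : atmost (fun _ : flag F => True) (10 * q ^+ 3).
Proof.
have q1 := card_ge1.
pose I := <[(const_mx 1 : vT)]>%VS.
have dI : \dim I = 1%N.
  by apply: dim_line; apply/eqP => /matrixP/(_ 0 0); rewrite !mxE => /eqP; rewrite oner_eq0.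
have lines : atmost (fun U : {vspace vT} => \dim U = 1%N) (1 + (q + 1) * (q + 1)).
  apply: (@atmost_or _ _ _ (fun U => U = I) (fun U => \dim U = 1%N /\ U != I)).
  - by move=> U dU; have [->|UI] := eqVneq U I; [left|right].
  - by apply: atmost1 => // U V -> ->.
  have planes := @atmost_planes R F _ I dI dim_col3.
  move=> s us hs; have sz := planes (undup [seq (U + I)%VS | U <- s]) (undup_uniq _).
  apply: (@le_trans _ _ ((size (undup [seq (U + I)%VS | U <- s]))%:R * (q + 1))).
    have hc : atmost (fun U => U \in s) ((size (undup [seq (U + I)%VS | U <- s]))%:R * (q + 1)).
      apply: (@atmost_cover_cst _ _ _ _ (fun (W U : {vspace vT}) => (\dim U = 1%N /\ U != I) /\ (U + I)%VS = W)).
        move=> U Us; exists (U + I)%VS.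
          by rewrite mem_undup; exact: (map_f (fun U : {vspace vT} => (U + I)%VS) Us).
        by split=> //; apply: hs.
      move=> W; rewrite mem_undup => /mapP[U0 /hs[dU0 nU0] WE].
      apply: atmost_sub (@atmost_lines R F _ W _); last by rewrite WE dim_line_join.
      by move=> U [[dU _] <-]; rewrite addvSl.
    exact: hc.
  rewrite ler_wpM2r ?addr_ge0 ?ler0n// sz// => W; rewrite mem_undup => /mapP[U /hs[dU nU] ->].
  by rewrite addvSr dim_line_join.
move=> s us _.
apply: (@le_trans _ _ ((size (undup [seq (val V).1 | V : flag F <- s]))%:R * (q + 1))).
  have hc : atmost (fun V : flag F => V \in s)
      ((size (undup [seq (val V).1 | V : flag F <- s]))%:R * (q + 1)).
    apply: (@atmost_cover_cst _ _ _ _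
      (fun (U : {vspace vT}) (V : flag F) => \dim U = 1%N /\ (val V).1 = U)).
      move=> V Vs; exists (val V).1.
        by rewrite mem_undup; exact: (map_f (fun V : flag F => (val V).1) Vs).
      by split=> //; have [] := flagP V.
    move=> U _; have [dU|dU] := eqVneq (\dim U) 1%N; last first.
      by apply: atmost0 => [V [/eqP]|]; rewrite ?(negbTE dU)// addr_ge0.
    apply: (@atmost_inj _ _ _ (fun V : flag F => (val V).2)) (@atmost_planes R F _ U dU dim_col3).
      by move=> V W [_ e1] [_ e2] e; apply: flag_eq => //; rewrite e1 e2.
    by move=> V [_ <-]; have [] := flagP V.
  exact: hc.
have le1 : (size (undup [seq (val V).1 | V : flag F <- s]))%:R <= 1 + (q + 1) * (q + 1).
  apply: lines; first exact: undup_uniq.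
  by move=> U; rewrite mem_undup => /mapP[V _ ->]; have [] := flagP V.
apply: (@le_trans _ _ ((1 + (q + 1) * (q + 1)) * (q + 1))); first by rewrite ler_wpM2r ?addr_ge0.
have h1 : q + 1 <= 2 * q by lra.
have h2 : 1 + (q + 1) * (q + 1) <= 5 * q ^+ 2 by nra.
apply: (@le_trans _ _ (5 * q ^+ 2 * (2 * q))); last first.
  by rewrite le_eqVlt; apply/orP; left; apply/eqP; ring.
by apply: ler_pM; rewrite ?addr_ge0 ?mulr_ge0 ?addr_ge0.
Qed.

(** Take a line [I0] in [I]. Either the flag's line is [I0] and its plane is a plane through [I0],
    or its plane is the join of [I0] with its line, which lies in [K]. *)
Lemma atmost_incident (K I : {vspace vT}) : (\dim K <= 2%N)%N -> (0 < \dim I)%N ->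
  atmost (fun V => ((val V).1 <= K)%VS /\ (I <= (val V).2)%VS) (4 * q).
Proof.
move=> dK dI; have q1 := card_ge1.
pose I0 := <[vpick I]>%VS.
have dI0 : \dim I0 = 1%N by apply: dim_line; rewrite vpick0 -dimv_eq0 -lt0n.
have I0I : (I0 <= I)%VS by rewrite -memvE memv_pick.
apply: (@atmost_le _ _ _ ((q + 1) + (q + 1))); first by lra.
apply: (@atmost_or _ _ _ (fun V => (val V).1 = I0 /\ (I0 <= (val V).2)%VS)
   (fun V => (val V).1 != I0 /\ ((val V).1 <= K)%VS /\ (I0 <= (val V).2)%VS)).
- move=> V [VK IV]; have IV0 := subv_trans I0I IV.
  by have [VI|VI] := eqVneq (val V).1 I0; [left|right].
- apply: (@atmost_inj _ _ _ (fun V : flag F => (val V).2)) (@atmost_planes R F _ I0 dI0 dim_col3).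
    by move=> V W [e1 _] [e2 _] e; apply: flag_eq => //; rewrite e1 e2.
  by move=> V [_ IV]; have [_ _ ->] := flagP V.
apply: (@atmost_inj _ _ _ (fun V : flag F => (val V).1)) (@atmost_lines R F _ K dK).
  have join V : (val V).1 != I0 -> (I0 <= (val V).2)%VS -> (val V).2 = ((val V).1 + I0)%VS.
    move=> VI IV; have [V12 d1 d2] := flagP V.
    by apply/esym/eqP; rewrite eqEdim subv_add V12 IV d2 dim_line_join.
  by move=> V W [V1 [_ IV]] [W1 [_ IW]] e; apply: flag_eq => //; rewrite (join V V1 IV) (join W W1 IW) e.
by move=> V [_ [VK _]]; have [_ -> _] := flagP V.
Qed.

(** * Flags fixed by one matrix *)

Section Fixed.
Variable G : 'M[F]_3.
Local Notation f := (mxlfun G).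

(** The transpose is there because [eigenvalue] refers to row vectors, while [G] acts on columns. *)
Definition eigs : seq F := [seq s <- enum F | root (char_poly G^T) s].

Lemma size_eigs : (size eigs <= 3%N)%N.
Proof.
have := @max_poly_roots _ (char_poly G^T) eigs.
rewrite -size_poly_eq0 size_char_poly => /(_ isT); apply; last exact/filter_uniq/enum_uniq.
by apply/allP => s; rewrite mem_filter => /andP[].
Qed.

Definition eigshift (s : F) : 'End(vT) := (f - s *: \1)%VF.

Lemma eigshiftE s (v : vT) : eigshift s v = G *m v - s *: v.
Proof. by rewrite add_lfunE opp_lfunE scale_lfunE id_lfunE mxlfunE. Qed.

Lemma mem_eigs s (v : vT) : v != 0 -> G *m v = s *: v -> s \in eigs.
Proof.
move=> v0 Gv; rewrite mem_filter mem_enum andbT -(@eigenvalue_root_char _ _ G^T s).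
apply/eigenvalueP; exists v^T; first by rewrite -trmx_mul Gv linearZ.
by rewrite -[0]trmx0 (inj_eq trmx_inj).
Qed.

Lemma ker_eigs s : lker (eigshift s) != 0%VS -> s \in eigs.
Proof.
rewrite -vpick0 => v0; apply: (mem_eigs v0); apply/eqP; rewrite -subr_eq0 -eigshiftE.
by have := memv_pick (lker (eigshift s)); rewrite memv_ker.
Qed.

Definition fixes V : Prop :=
  (f @: (val V).1 <= (val V).1)%VS /\ (f @: (val V).2 <= (val V).2)%VS.

Lemma line_eig (U : {vspace vT}) : \dim U = 1%N -> (f @: U <= U)%VS ->
  exists2 s, s \in eigs & (U <= lker (eigshift s))%VS.
Proof.
move=> dU fU; have UE : U = <[vpick U]>%VS by apply: vpick_line; rewrite dU.
have v0 : vpick U != 0 by rewrite vpick0 -dimv_eq0 dU.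
have /vlineP[s fv] : f (vpick U) \in <[vpick U]>%VS.
  by rewrite -UE (subvP fU)// memv_img// memv_pick.
rewrite mxlfunE in fv; exists s; first exact: mem_eigs fv.
by rewrite UE -memvE memv_ker eigshiftE fv subrr.
Qed.

Lemma ker_img_dim s : (\dim (lker (eigshift s)) + \dim (limg (eigshift s)) = 3%N)%N.
Proof. by have := limg_ker_dim (eigshift s) {: vT}; rewrite capfv dim_col3. Qed.

(** [G] acts on the one-dimensional quotient by [W] as a scalar [s], so [G - s] maps everything into
    [W]; its kernel is then nonzero by rank. *)
Lemma plane_eig (W : {vspace vT}) : \dim W = 2%N -> (f @: W <= W)%VS ->
  exists2 s, s \in eigs & (limg (eigshift s) <= W)%VS.
Proof.
move=> dW fW; have dC : \dim (W^C)%VS = 1%N by rewrite dimv_compl dim_col3 dW.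
have CE : (W^C)%VS = <[vpick (W^C)%VS]>%VS by apply: vpick_line; rewrite dC.
set v := vpick _ in CE.
have dec x : exists2 w, w \in W & exists a, x = w + a *: v.
  have : x \in (W + W^C)%VS by rewrite addv_complf memvf.
  by rewrite CE => /memv_addP[w wW [y /vlineP[a ->] ->]]; exists w => //; exists a.
have [w wW [s fv]] := dec (f v).
have sub : (limg (eigshift s) <= W)%VS.
  apply/subvP => y /memv_imgP[x _ ->]; have [u uW [a ->]] := dec x.
  rewrite linearD linearZ /= !eigshiftE -!(mxlfunE G) fv addrK.
  by rewrite memvD ?memvZ// memvB ?memvZ// (subvP fW)// memv_img.
exists s => //; apply: ker_eigs; rewrite -dimv_eq0.
have := dimvS sub; rewrite dW; have := ker_img_dim s.
by move: (\dim _) (\dim _) => m n; lia.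
Qed.

(** Replaces invariance by incidence with a kernel and an image, for at most 9 pairs of
    eigenvalues. *)
Lemma fixes_eigs V : fixes V -> exists2 st, st \in [seq (s, t) | s <- eigs, t <- eigs] &
  ((val V).1 <= lker (eigshift st.1))%VS /\ (limg (eigshift st.2) <= (val V).2)%VS.
Proof.
case=> f1 f2; have [_ d1 d2] := flagP V.
have [s se hs] := line_eig d1 f1; have [t te ht] := plane_eig d2 f2.
by exists (s, t) => //; apply: allpairs_f.
Qed.

Lemma size_pairs : (size [seq (s, t) | s <- eigs, t <- eigs])%:R <= 9 :> R.
Proof. by rewrite size_allpairs ler_nat (@leq_mul _ _ 3 3)// size_eigs. Qed.

Lemma scalar_ker s : \dim (lker (eigshift s)) = 3%N -> G = s%:M.
Proof.
move=> d3; have K : lker (eigshift s) = {: vT}%VS by apply/eqP; rewrite eqEdim subvf d3 dim_col3.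
have h (v : vT) : G *m v = s *: v.
  by apply/eqP; rewrite -subr_eq0 -eigshiftE -memv_ker K memvf.
apply/matrixP => i j; have /colP/(_ i) := h (delta_mx j 0).
by rewrite -colE !mxE eqxx andbT mulr_natr.
Qed.

(** For nonscalar [G] every kernel is at most a plane and every image is nonzero, so
    [atmost_incident] applies to each of the 9 pairs. *)
Lemma atmost_fixes_nonscalar : (forall s, G <> s%:M) -> atmost fixes (36 * q).
Proof.
move=> ns; apply: (@atmost_le _ _ _ ((size [seq (s, t) | s <- eigs, t <- eigs])%:R * (4 * q))).
  by rewrite (_ : 36 * q = 9 * (4 * q)); [rewrite ler_wpM2r ?mulr_ge0 ?size_pairs|ring].
apply: atmost_cover_cst fixes_eigs _ => st _.
have le2 s : (\dim (lker (eigshift s)) <= 2%N)%N.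
  have := ker_img_dim s; case: (eqVneq (\dim (lker (eigshift s))) 3%N) => [/scalar_ker/ns//|]; lia.
apply: atmost_incident; first exact: le2.
by rewrite -(ltn_add2l (\dim (lker (eigshift st.2)))) ker_img_dim addn0 ltnS le2.
Qed.

(** The images have dimension at least 2, so each pair of eigenvalues determines the line as a
    kernel and the plane as an image. *)
Lemma atmost_fixes_cyclic : (forall s, \dim (lker (eigshift s)) <= 1)%N -> atmost fixes (9 : R).
Proof.
move=> le1; apply: (@atmost_le _ _ _ ((size [seq (s, t) | s <- eigs, t <- eigs])%:R * 1)).
  by rewrite mulr1 size_pairs.
apply: atmost_cover_cst fixes_eigs _ => st _; apply: atmost1 => // V W [V1 V2] [W1 W2].
have [_ dV1 dV2] := flagP V; have [_ dW1 dW2] := flagP W.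
have e1 (U : {vspace vT}) : \dim U = 1%N -> (U <= lker (eigshift st.1))%VS -> U = lker (eigshift st.1).
  by move=> dU UK; apply/eqP; rewrite eqEdim UK dU le1.
have e2 (U : {vspace vT}) : \dim U = 2%N -> (limg (eigshift st.2) <= U)%VS -> U = limg (eigshift st.2).
  move=> dU UK; apply/esym/eqP; rewrite eqEdim UK dU.
  by rewrite -(leq_add2l (\dim (lker (eigshift st.2)))) ker_img_dim (@leq_add2r 2 _ 1) le1.
by apply: flag_eq; [rewrite (e1 _ dV1 V1) (e1 _ dW1 W1)|rewrite (e2 _ dV2 V2) (e2 _ dW2 W2)].
Qed.

Lemma adj3_of_ker s : (1 < \dim (lker (eigshift s)))%N ->
  exists l mu, adj3 G = l%:M + mu *: G.
Proof.
move=> d2; have /vpick_line iE : (\dim (limg (eigshift s)) <= 1)%N.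
  by rewrite -(leq_add2l (\dim (lker (eigshift s)))) ker_img_dim (@leq_add2r 1 2).
set p := vpick _ in iE.
have col j : exists a, G *m delta_mx j 0 = s *: delta_mx j 0 + a *: p.
  have /vlineP[a aE] : eigshift s (delta_mx j 0) \in <[p]>%VS by rewrite -iE memv_img ?memvf.
  by exists a; rewrite -aE eigshiftE addrC subrK.
pose l j := sval (cid (col j)).
have GE i j : G i j = s *+ (i == j) + l j * p i 0.
  have /colP/(_ i) := svalP (cid (col j)); rewrite -/(l j) -colE !mxE eqxx andbT.
  by rewrite mulr_natr.
(* [G] is s + N with N of rank at most 1, and the adjugate of s + N is s^2 + s tr N - s N;
   substitute N = G - s. *)
exists (2 * s ^+ 2 + s * (l i0 * p i0 0 + l i1 * p i1 0 + l i2 * p i2 0)), (- s).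
apply/matrixP => i j; case: (I3P i) => ->; case: (I3P j) => ->;
  rewrite adj3E mxE [in RHS]mxE [X in _ = _ + X]mxE !GE /= ?mulr1n ?mulr0n; ring.
Qed.

End Fixed.
End Flags.

(** * The main estimate *)

Lemma atmost_pairs (R : realFieldType) (T1 T2 : eqType) (P : T1 -> T2 -> Prop)
    (S : T1 -> Prop) (N1 N2 : R) :
    (forall x y, P x y -> S x) -> atmost S N1 -> 0 <= N2 ->
    (forall x, S x -> atmost (P x) N2) ->
  atmost (fun p : T1 * T2 => P p.1 p.2) (N1 * N2).
Proof.
move=> PS h1 N20 h2 s us Ps; pose L := undup [seq p.1 | p <- s].
have hc : atmost (fun p : T1 * T2 => p \in s) ((size L)%:R * N2).
  apply: (@atmost_cover_cst _ _ _ _ (fun (x : T1) (p : T1 * T2) => P p.1 p.2 /\ p.1 = x)).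
    by move=> p ps; exists p.1; [rewrite mem_undup map_f|split=> //; apply: Ps].
  move=> x; rewrite mem_undup => /mapP[p0 /Ps/PS Sx xE].
  apply: (@atmost_inj _ _ _ (fun p : T1 * T2 => p.2)) (h2 x _); last by rewrite xE.
    by move=> [x1 y1] [x2 y2] /= [_ ->] [_ ->] ->.
  by move=> [x1 y1] /= [Pxy <-].
apply: le_trans (hc s us _) _ => //; rewrite ler_wpM2r// h1 ?undup_uniq// => x.
by rewrite mem_undup => /mapP[p /Ps/PS Sx ->].
Qed.

(** An infinite set would contain a finite subset with more than [N] elements. *)
Lemma counting_le (R : realType) (T : choiceType) (X : set T) (N : R) :
  atmost X N -> (counting X <= N%:E)%E.
Proof.
move=> h; rewrite /counting; case: asboolP => [fX|iX].
  rewrite lee_fin h ?finmap.fset_uniq// => x.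
  by rewrite in_fset_set// inE.
have N0 : 0 <= N by rewrite -[0]/((size (Nil T))%:R) h.
have [B BX sB] := infinite_set_fset (Num.truncn N).+1 iX.
have := h (finmap.enum_fset B) (finmap.fset_uniq B) (fun x xB => BX x xB).
have lt : N < (Num.truncn N).+1%:R by rewrite truncnS_gt.
by rewrite leNgt (lt_le_trans lt)// ler_nat.
Qed.

(** The harmonic sum is at most the binary logarithm of [q ^ 3] plus 2, and [1 + x <= expR x] bounds
    a logarithm by a power. *)
Lemma harm_powR (R : realType) (e : R) : 0 < e ->
  exists2 A : R, 0 <= A & forall q : nat, (0 < q)%N -> harm R (q ^ 3) <= A * q%:R `^ e.
Proof.
move=> e0; have l2 : 0 < ln 2 :> R by rewrite ln_gt0// ltr1n.
exists (2 + 3 / (e * ln 2)); first by rewrite addr_ge0// divr_ge0// mulr_ge0// ltW.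
move=> q q0; set l := trunc_log 2 (q ^ 3).
have q0' : 0 < q%:R :> R by rewrite ltr0n.
apply: le_trans (harm_log _ _) _; rewrite -/l.
have lq : l%:R * ln 2 <= 3 * ln q%:R :> R.
  rewrite !mulr_natl -!lnXn// ler_ln ?posrE ?exprn_gt0// -!natrX ler_nat.
  by apply: trunc_logP; rewrite // expn_gt0 q0.
have pw : 1 + e * (l%:R * ln 2 / 3) <= q%:R `^ e.
  rewrite /powR gt_eqF//; apply: le_trans (expR_ge1Dx _).
  by rewrite lerD2l ler_pM2l// ler_pdivrMr// [leRHS]mulrC.
have A0 : 0 <= 2 + 3 / (e * ln 2) by rewrite addr_ge0// divr_ge0// mulr_ge0// ltW.
apply: le_trans (ler_wpM2l A0 pw).
have l0 : 0 <= l%:R :> R by [].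
have -> : (2 + 3 / (e * ln 2)) * (1 + e * (l%:R * ln 2 / 3)) =
   2 + l%:R + (2 * (e * (l%:R * ln 2 / 3)) + 3 / (e * ln 2)).
  by field; rewrite !gt_eqF.
rewrite -[l.+2]addn2 natrD addrC lerDl addr_ge0//.
  by rewrite !mulr_ge0// ltW.
by rewrite divr_ge0// mulr_ge0// ltW.
Qed.

Lemma entry_le_norm (A : 'M[int]_3) i j : (`|A i j| <= `|(`|A|)%R|)%N.
Proof.
have h : `|A i j| <= `|A|.
  by rewrite [leRHS]mx_normrE; apply: (le_bigmax _ (fun ij => `|A ij.1 ij.2|) (i, j)).
by move: h; lia.
Qed.

Lemma fixed_entries (R : realType) (q : nat) (T : R) g V :
  fixed_pairs q T (g, V) -> entries_le (Num.truncn T) (SL3Z_val g).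
Proof.
case=> /= hT _; exists `|(`|SL3Z_val g|)%R|%N, `|(`|invmx (SL3Z_val g)|)%R|%N; split.
- exact: entry_le_norm.
- by move=> i j; rewrite -invmx3; [exact: entry_le_norm|case: (g) => A /= /eqP].
rewrite truncn_ge_nat; last by apply: le_trans hT; rewrite ler0z mulr_ge0.
by apply: le_trans hT; rewrite -abszM natr_absz ger0_norm// mulr_ge0.
Qed.

Lemma fixed_fixes (R : realType) (q : nat) (T : R) g V :
  fixed_pairs q T (g, V) -> fixes (redmod q g) V.
Proof.
case=> /= _; rewrite /Phi permE => e; split.
  by have e1 := congr1 (fun W : flag _ => (val W).1) e; rewrite -[X in (_ <= X)%VS]e1.
by have e2 := congr1 (fun W : flag _ => (val W).2) e; rewrite -[X in (_ <= X)%VS]e2.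
Qed.

Lemma redmod_adj3 q (A : 'M[int]_3) : redmod q (adj3 A) = adj3 (redmod q A).
Proof.
apply/matrixP => i j; case: (I3P i) => ->; case: (I3P j) => ->;
  by rewrite mxE !adj3E !mxE rmorphB !rmorphM.
Qed.

Section Count.
Variables (R : realType) (q T : nat).
Hypotheses (pq : prime q) (T0 : (0 < T)%N) (Tq : (32 * T < q ^ 3)%N).

Let small (A : 'M[int]_3) : Prop := [/\ \det A = 1, A <> 1%:M & entries_le T A].
Local Notation h := (harm R (q ^ 3)).

Lemma atmost_small_scalar : atmost (fun A => small A /\ exists s : 'F_q, redmod q A = s%:M)
  (12 * (6 * 83 ^+ 4 * (16 * T)%:R) : R).
Proof.
apply: (@atmost_sub _ _ _ (fun A => [/\ \det A = 1, A <> 1%:M, entries_le T A &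
    exists s : 'F_q, redmod q A = s%:M])); first by move=> A [[]].
apply: atmost_conj; first by move=> sb A _; apply: scalar_conjby.
apply: (@atmost_scalar R q 40 (16 * T) pq); rewrite ?muln_gt0//.
by apply: leq_ltn_trans Tq; rewrite -mul2n mulnA.
Qed.

(** By [pivoted_cube], the cube of the corner is at most 2 (16 T)^2 <= (32 T)^2 < q^6. This is the
    value of [B] given to [atmost_pivoted]. *)
Lemma pivot_le_sqr A : pivoted 40 (16 * T) A -> (`|A i0 i2| <= q ^ 2)%N.
Proof.
move=> pA; rewrite -(@leq_exp2r _ _ 3)// -expnM.
apply: leq_trans (pivoted_cube pA) _; rewrite -[(2 * 3)%N]/(3 * 2)%N expnM.
apply: (@leq_trans ((2 * (16 * T)) ^ 2)); first by rewrite [leqRHS]expnMn leq_mul.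
by rewrite leq_exp2r// mulnA ltnW.
Qed.

(** Used with [m = q] for derogatory matrices and with [m = 1] for arbitrary ones. *)
Lemma atmost_small_congr (m : nat) (E : 'M[int]_3 -> Prop) : (m = 1 \/ prime m)%N ->
    (forall sb A, \det A = 1 -> E A -> E (conjby sb A)) ->
    (forall A, E A -> (m %| A i1 i2 * w1 A - A i0 i2 * w2 A)%Z) ->
  atmost (fun A => small A /\ E A) (12 * (216 * 83 ^+ 4 * h ^+ 3 *
    ((16 * T)%:R ^+ 2 / m%:R + (16 * T)%:R * (q ^ 2)%:R))).
Proof.
move=> m1p EE Em.
apply: (@atmost_sub _ _ _ (fun A => [/\ \det A = 1, A <> 1%:M, entries_le T A & E A])).
  by move=> A [[]].
apply: (atmost_conj EE).
apply: (atmost_sub _ (@atmost_pivoted R m 40 (16 * T) (q ^ 2) (q ^ 3) m1p _ _ _)).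
- by move=> A [pA EA]; split=> //; [exact: pivot_le_sqr|exact: Em].
- by rewrite muln_gt0.
- by rewrite leq_exp2l// prime_gt1.
- by rewrite -mul2n mulnA ltnW.
Qed.

Lemma derogatory_or_cyclic (A : 'M[int]_3) :
  derogatory q A \/ (forall s : 'F_q, \dim (lker (eigshift (redmod q A) s)) <= 1)%N.
Proof.
case: (pselect (derogatory q A)) => [|nb]; [by left|right=> s].
rewrite leqNgt; apply/negP => /adj3_of_ker[l [mu e]]; apply: nb.
by exists l, mu; rewrite redmod_adj3.
Qed.

(* The contributions of the identity, of the other scalar matrices mod [q], of the
   derogatory nonscalar ones, and of the remaining ones; 83 = 2 * 40 + 3. *)
Definition pair_bound : R := 10 * q%:R ^+ 3 + 12 * (6 * 83 ^+ 4 * (16 * T)%:R) * (10 * q%:R ^+ 3)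
  + 12 * (216 * 83 ^+ 4 * h ^+ 3 * ((16 * T)%:R ^+ 2 / q%:R + (16 * T)%:R * (q ^ 2)%:R)) * (36 * q%:R)
  + 12 * (216 * 83 ^+ 4 * h ^+ 3 * ((16 * T)%:R ^+ 2 / 1%:R + (16 * T)%:R * (q ^ 2)%:R)) * 9.

Lemma atmost_pairs_bound (P : SL3Z -> flag 'F_q -> Prop) :
    (forall g V, P g V -> entries_le T (SL3Z_val g)) ->
    (forall g V, P g V -> fixes (redmod q g) V) ->
  atmost (fun p : SL3Z * flag 'F_q => P p.1 p.2) pair_bound.
Proof.
move=> PT Pf; have cF : #|'F_q| = q by rewrite card_Fp.
have atmost_val (S : 'M[int]_3 -> Prop) (N : R) : atmost S N -> atmost (fun g : SL3Z => S (SL3Z_val g)) N.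
  by apply: (@atmost_inj _ _ _ (fun g : SL3Z => SL3Z_val g)) => // g g' _ _; apply: val_inj.
pose P1 g V := P g V /\ SL3Z_val g = 1%:M.
pose P2 g V := P g V /\ (small g /\ exists s : 'F_q, redmod q g = s%:M).
pose P3 g V := P g V /\ (small g /\ derogatory q g) /\ (forall s : 'F_q, redmod q g <> s%:M).
pose P4 g V := P g V /\ (small g /\ True) /\ (forall s : 'F_q, \dim (lker (eigshift (redmod q g) s)) <= 1)%N.
apply: (@atmost_or _ _ _ (fun p => P1 p.1 p.2 \/ P2 p.1 p.2 \/ P3 p.1 p.2) (fun p => P4 p.1 p.2)).
- move=> [g V] /= Pg; have [g1|g1] := pselect (SL3Z_val g = 1%:M); first by left; left.
  have sg : small g by split=> //; [case: (g) => A /= /eqP|exact: PT Pg].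
  have [sc|nsc] := pselect (exists s : 'F_q, redmod q g = s%:M); first by left; right; left.
  have [bg|cg] := derogatory_or_cyclic g; last by right.
  by left; right; right; split=> //; split=> // s e; apply: nsc; exists s.
- rewrite -addrA; apply: (@atmost_or _ _ _ (fun p => P1 p.1 p.2) (fun p => P2 p.1 p.2 \/ P3 p.1 p.2)) => //.
    rewrite -[10 * _]mul1r; apply: (@atmost_pairs _ _ _ P1 (fun g => SL3Z_val g = 1%:M)).
    + by move=> g V [].
    + by apply: atmost1 => // g g' e e'; apply: val_inj; rewrite /= e e'.
    + by rewrite mulr_ge0 ?exprn_ge0.
    + by move=> g _; have := @atmost_flags R 'F_q; rewrite cF; apply: atmost_sub.
  apply: (@atmost_or _ _ _ (fun p => P2 p.1 p.2) (fun p => P3 p.1 p.2)) => //.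
    apply: (@atmost_pairs _ _ _ P2 (fun g => small (SL3Z_val g) /\ exists s : 'F_q, redmod q g = s%:M)).
    + by move=> g V [].
    + exact: atmost_val atmost_small_scalar.
    + by rewrite mulr_ge0 ?exprn_ge0.
    + by move=> g _; have := @atmost_flags R 'F_q; rewrite cF; apply: atmost_sub.
  apply: (@atmost_pairs _ _ _ P3 (fun g => (small (SL3Z_val g) /\ derogatory q g) /\ (forall s : 'F_q, redmod q g <> s%:M))).
  + by move=> g V [].
  + apply: atmost_sub (atmost_val _ _ (@atmost_small_congr q (derogatory q) (or_intror pq) _ _)).
    * by move=> g [].
    * by move=> sb A; apply: derogatory_conjby.
    * by move=> A; apply: derogatory_dvd.
  + by rewrite mulr_ge0.
  + move=> g [_ ns]; have := @atmost_fixes_nonscalar R _ _ ns; rewrite cF.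
    by apply: atmost_sub => V [/Pf].
- apply: (@atmost_pairs _ _ _ P4 (fun g => (small (SL3Z_val g) /\ True) /\
     (forall s : 'F_q, \dim (lker (eigshift (redmod q g) s)) <= 1)%N)).
  + by move=> g V [].
  + apply: atmost_sub (atmost_val _ _ (@atmost_small_congr 1 (fun=> True) (or_introl erefl) _ _)) => //.
      by move=> g [].
  + by rewrite ler0n.
  + move=> g [_ le1]; apply: atmost_sub (@atmost_fixes_cyclic R _ _ le1).
    by move=> V [/Pf].
Qed.

(** Since [32 * T < q ^ 3], the squares satisfy 256 T^2 <= 8 q^3 T, which explains 24 = 8 + 16
    below. The four coefficients add up to 10 + 11520 + 2592 * 24 * (36 + 9) = 2810890. *)
Lemma pair_bound_le : pair_bound <= 3 * 10 ^+ 6 * 83 ^+ 4 * h ^+ 3 * q%:R ^+ 3 * T%:R.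
Proof.
have q0 : 0 < q%:R :> R by rewrite ltr0n prime_gt0.
have Q0 : 0 <= q%:R ^+ 3 :> R by rewrite exprn_ge0// ltW.
have h1 : 1 <= h by apply: harm_ge1; rewrite expn_gt0 prime_gt0.
have h31 : 1 <= h ^+ 3 by rewrite exprn_ege1.
have T1 : 1 <= T%:R :> R by rewrite ler1n.
have TQ : 32 * T%:R <= q%:R ^+ 3 :> R by rewrite -natrX -natrM ler_nat ltnW.
have q2Q : q%:R ^+ 2 <= q%:R ^+ 3 :> R by apply: ler_weXn2l; rewrite ?ler1n ?prime_gt0.
have K1 : 1 <= 83 ^+ 4 :> R by rewrite exprn_ege1// ler1n.
have tT : 32 * (T%:R * T%:R) <= T%:R * q%:R ^+ 3 :> R.
  by rewrite mulrCA ler_wpM2l.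
have hQT : q%:R ^+ 3 <= h ^+ 3 * (q%:R ^+ 3 * T%:R).
  by rewrite -[leLHS]mul1r ler_pM// ler_peMr.
have hTQ : q%:R ^+ 3 * T%:R <= h ^+ 3 * (q%:R ^+ 3 * T%:R).
  by rewrite ler_peMl// mulr_ge0.
have KQ : q%:R ^+ 3 <= 83 ^+ 4 * (h ^+ 3 * (q%:R ^+ 3 * T%:R)).
  by rewrite (le_trans hQT)// ler_peMl// (le_trans Q0).
have h30 : 0 <= h ^+ 3 by apply: le_trans h31.
have e3 : ((16 * T)%:R ^+ 2 / q%:R + (16 * T)%:R * (q ^ 2)%:R) * q%:R
    <= 24 * (q%:R ^+ 3 * T%:R) :> R.
  rewrite natrX !natrM.
  have -> : ((16 * T%:R) ^+ 2 / q%:R + 16 * T%:R * q%:R ^+ 2) * q%:R =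
    256 * (T%:R * T%:R) + 16 * (q%:R ^+ 3 * T%:R) :> R by field; rewrite gt_eqF.
  by rewrite [q%:R ^+ 3 * _]mulrC; lra.
have e4 : (16 * T)%:R ^+ 2 / 1%:R + (16 * T)%:R * (q ^ 2)%:R
    <= 24 * (q%:R ^+ 3 * T%:R) :> R.
  rewrite natrX !natrM divr1.
  have : T%:R * q%:R ^+ 2 <= T%:R * q%:R ^+ 3 :> R by rewrite ler_wpM2l.
  have -> : (16 * T%:R) ^+ 2 + 16 * T%:R * q%:R ^+ 2 =
    256 * (T%:R * T%:R) + 16 * (T%:R * q%:R ^+ 2) :> R by ring.
  by rewrite [q%:R ^+ 3 * _]mulrC; lra.
have c0 : 0 <= 83 ^+ 4 * h ^+ 3 :> R by rewrite mulr_ge0// (le_trans _ K1).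
have f3 := ler_wpM2l c0 e3; have f4 := ler_wpM2l c0 e4.
have f2 : 83 ^+ 4 * (q%:R ^+ 3 * T%:R) <= 83 ^+ 4 * (h ^+ 3 * (q%:R ^+ 3 * T%:R)) :> R.
  by rewrite ler_wpM2l// (le_trans _ K1).
rewrite /pair_bound; rewrite natrM in f3 f4 *.
move: Q0 KQ f2 f3 f4; move: (83 ^+ 4) => k; set M := 16%:R * T%:R.
set B3 := M ^+ 2 / q%:R + _; set B4 := M ^+ 2 / 1%:R + _.
move: (q%:R ^+ 3) (h ^+ 3) => Q H Q0 KQ f2 f3 f4.
have -> : 12 * (6 * k * M) * (10 * Q) = 96 * 120 * (k * (Q * T%:R)) by rewrite /M; ring.
have -> : 12 * (216 * k * H * B3) * (36 * q%:R) = 2592 * 36 * (k * H * (B3 * q%:R)) by ring.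
have -> : 12 * (216 * k * H * B4) * 9 = 2592 * 9 * (k * H * B4) by ring.
have -> : 3 * 10 ^+ 6 * k * H * Q * T%:R = 3 * 10 ^+ 6 * (k * (H * (Q * T%:R))) by ring.
have E : k * H * (24 * (Q * T%:R)) = 24 * (k * (H * (Q * T%:R))) by ring.
rewrite !E in f3 f4; move: f2 f3 f4 KQ.
move: (k * (H * (Q * T%:R))) (k * (Q * T%:R)) (k * H * (B3 * q%:R)) (k * H * B4).
by clear -Q0; move=> x x2 x3 x4; lra.
Qed.

End Count.

Theorem theorem5p2 (R : realType) :
  exists2 C : R, 0 < C &
    forall eps : R, 0 < eps ->
      exists A : R,
        forall (q : nat) (T : R), prime q -> 0 <= T -> T <= C * q%:R ^+ 3 ->
          (counting (fixed_pairs q T) <= (A * q%:R `^ (3 + eps) * T)%:E)%E.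
Proof.
(* With this [C], 32 T is at most q^3 / 2, which gives the strict inequality [tq]. *)
exists (1 / 64) => // eps eps0.
(* The harmonic factor enters cubed, so each copy may cost [eps / 3]. *)
have e3 : 0 < eps / 3 by rewrite divr_gt0.
have [A A0 hA] := harm_powR e3.
exists (3 * 10 ^+ 6 * 83 ^+ 4 * A ^+ 3) => q T pq T0 TC.
have q0 : (0 < q)%N := prime_gt0 pq.
have qr0 : 0 < q%:R :> R by rewrite ltr0n.
set t := Num.truncn T.
have tT : t%:R <= T by rewrite truncn_le.
have rhs0 : 0 <= 3 * 10 ^+ 6 * 83 ^+ 4 * A ^+ 3 * q%:R `^ (3 + eps) * T.
  by rewrite !mulr_ge0 ?exprn_ge0 ?powR_ge0.
apply: counting_le.
(* For [T < 1] there is no pair at all: an integer matrix of determinant 1 and its inverse both have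
   norm at least 1. *)
have [t0|t0] := posnP t.
  apply: atmost0 => // -[g V] /fixed_entries[X [Y [hX hY XY]]].
  have dg : \det (SL3Z_val g) = 1 by case: (g) => B /= /eqP.
  have X0 : (0 < X)%N.
    rewrite lt0n; apply/eqP => X0; have B0 k l : SL3Z_val g k l = 0 by have := hX k l; rewrite X0 leqn0 absz_eq0 => /eqP.
    by move: dg; rewrite det3 !B0 !mul0r ?subr0 ?addr0.
  have Y0 : (0 < Y)%N.
    rewrite lt0n; apply/eqP => Y0; have B0 k l : adj3 (SL3Z_val g) k l = 0 by have := hY k l; rewrite Y0 leqn0 absz_eq0 => /eqP.
    have := mul_adj3 (SL3Z_val g); rewrite dg => /matrixP/(_ i0 i0).
    by rewrite !mxE big_I3 !B0 !mulr0 !addr0.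
  by move: XY; rewrite -/t t0 leqn0 muln_eq0 !eqn0Ngt X0 Y0.
have tq : (32 * t < q ^ 3)%N.
  rewrite -(ltr_nat R) natrM natrX.
  have : 0 < q%:R ^+ 3 :> R by rewrite exprn_gt0.
  by move: (_ ^+ 3) TC tT => Q TC tT Q0; lra.
apply: (@atmost_le _ _ _ (pair_bound R q t)); last first.
  apply: (@atmost_sub _ _ _ (fun p : SL3Z * flag 'F_q => fixed_pairs q T (p.1, p.2))) => [[]//|].
  apply: (@atmost_pairs_bound R q t pq t0 tq (fun g V => fixed_pairs q T (g, V))).
    by move=> g V; apply: fixed_entries.
  by move=> g V; apply: fixed_fixes.
apply: le_trans (pair_bound_le _ pq t0 tq) _.
have -> : q%:R `^ (3 + eps) = q%:R ^+ 3 * (q%:R `^ (eps / 3)) ^+ 3 :> R.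
  rewrite powRD; last by apply/implyP => _; rewrite gt_eqF.
  congr (_ * _); first by rewrite powR_mulrn// ltW.
  by rewrite -[RHS]powR_mulrn ?powR_ge0// -powRrM; congr (_ `^ _); field.
have -> : 3 * 10 ^+ 6 * 83 ^+ 4 * A ^+ 3 * (q%:R ^+ 3 * (q%:R `^ (eps / 3)) ^+ 3) * T =
  3 * 10 ^+ 6 * 83 ^+ 4 * (A * q%:R `^ (eps / 3)) ^+ 3 * q%:R ^+ 3 * T.
  by rewrite exprMn; move: (3 * 10 ^+ 6 * 83 ^+ 4) => D; ring.
rewrite ler_pM ?mulr_ge0 ?exprn_ge0 ?harm_ge0//.
rewrite ler_wpM2r ?exprn_ge0// ler_wpM2l ?mulr_ge0 ?exprn_ge0//.
by rewrite lerXn2r ?nnegrE ?harm_ge0 ?mulr_ge0 ?powR_ge0 ?hA.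
Qed.
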